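(* Let $r\in\{1,2\}$, let $\mu_1,\dots,\mu_{2r}\in\mathbb{C}$ be distinct, and let $p_i=[1:\mu_i]\in\mathbb{CP}^1$. Let $$a:\mathcal{H}(\mathbb{CP}^1,2r)\to\mathcal{P}^{ss}(\mathbb{CP}^1,2r),\quad K:\mathcal{H}(\mathbb{CP}^1,2r)\to\mathcal{Y}(S^2,2r),\quad w:\mathcal{Y}(S^2,2r)\to\mathcal{P}^{ss}(\mathbb{CP}^1,2r)$$ be respectively the Hecke embedding, the Kamnitzer isomorphism and the Woodward embedding (defined in the context), and let $\phi_*:\mathcal{P}^{ss}(\mathbb{CP}^1,2r)\to\mathcal{P}^{ss}(\mathbb{CP}^1,2r)$ be the isomorphism $(\mathcal{O}\oplus\mathcal{O},\ell_{p_1},\dots,\ell_{p_{2r}})\mapsto(\mathcal{O}\oplus\mathcal{O},\phi(\ell_{p_1}),\dots,\phi(\ell_{p_{2r}}))$ induced by $$\phi=\begin{pmatrix}0&-1\\1&0\end{pmatrix}\in \mathrm{Aut}(\mathcal{O}\oplus\mathcal{O})=GL(2,\mathbb{C}).$$ Then the corresponding square commutes: $\phi_*\circ a=w\circ K$.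
   Context: Hecke modifications. A Hecke modification of a rank 2 holomorphic bundle $E$ over a curve $C$ at a point $p$ is a rank 2 bundle $F$ with a bundle map $\alpha:F\to E$ that is an isomorphism on fibers away from $p$ and that, in a local coordinate $z$ centered at $p$ and suitable local trivializations of $E$ and $F$ near $p$, is given by the matrix $\mathrm{diag}(1,z)$. A sequence of Hecke modifications of $E_0$ at $(p_1,\dots,p_n)$ consists of Hecke modifications $\alpha_i:E_i\to E_{i-1}$ at $p_i$, $i=1,\dots,n$; two such sequences $(E_i,\alpha_i)$, $(E_i',\alpha_i')$ with $E_0=E_0'$ are equivalent if there are isomorphisms $\phi_i:E_i\to E_i'$ for $i\ge1$ with $\phi_{i-1}\circ\alpha_i=\alpha_i'\circ\phi_i$, where $\phi_0=\mathrm{id}$. The Kamnitzer space $\mathcal{H}(\mathbb{CP}^1,2r)$ is the set (a complex manifold) of equivalence classes of sequences of Hecke modifications of $E_0=\mathcal{O}\oplus\mathcal{O}$ over $\mathbb{CP}^1$ at $(p_1,\dots,p_{2r})$ such that $E_{2r}$ is semistable. $\mathcal{P}^{ss}(\mathbb{CP}^1,n)$ is the space of tuples $(\mathcal{O}\oplus\mathcal{O},\ell_{p_1},\dots,\ell_{p_n})$ of lines $\ell_{p_i}\in\mathbb{P}((\mathcal{O}\oplus\mathcal{O})_{p_i})$ which are semistable as parabolic bundles; identifying all fibers of $\mathcal{O}\oplus\mathcal{O}$ with $\mathbb{C}^2$ by the standard global trivialization, so that lines are points of $\mathbb{CP}^1$, this means that at most $n/2$ of the lines are equal to any given line. Hecke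 embedding $a$: it sends $[E_0\xleftarrow{\alpha_1}E_1\leftarrow\cdots\xleftarrow{\alpha_{2r}}E_{2r}]$ to $(\mathcal{O}\oplus\mathcal{O},\ell_{p_1},\dots,\ell_{p_{2r}})$ with $\ell_{p_i}=\mathrm{im}\big((\alpha_1\circ\cdots\circ\alpha_i)_{p_i}:(E_i)_{p_i}\to(E_0)_{p_i}\big)$. Seidel–Smith space: $S_{2r}\subset\mathfrak{gl}(2r,\mathbb{C})$ is the set of matrices, written in $2\times2$ blocks, with identity blocks on the block superdiagonal, arbitrary blocks in the left block column, and zeros elsewhere; $\mathcal{Y}(S^2,2r)\subset S_{2r}$ is the set of matrices with eigenvalues $\mu_1,\dots,\mu_{2r}$ (characteristic polynomial $\prod_i(t-\mu_i)$). Kamnitzer isomorphism $K$: let $U=\{[1:z]\mid z\in\mathbb{C}\}\subset\mathbb{CP}^1$, let $e^1=(1,0)$, $e^2=(0,1)$ be the standard sections of $E_0=\mathcal{O}\oplus\mathcal{O}$, and let $L_i$ be the free rank 2 $\mathbb{C}[z]$-module of (algebraic) sections of $E_i$ over $U$, so $L_0=\mathbb{C}[z]e^1\oplus\mathbb{C}[z]e^2$. The maps $\alpha_i$ induce $\bar\alpha_i:L_i\to L_{i-1}$. The quotient $V=L_0/(\bar\alpha_1\circ\cdots\circ\bar\alpha_{2r})(L_{2r})$ is a $2r$-dimensional complex vector space with ordered basis $(z^{r-1}e^1,z^{r-1}e^2,\dots,ze^1,ze^2,e^1,e^2)$. $K$ sends the class of the sequence to the matrix $A$ of multiplication by $z$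 on $V$ in this basis (acting on column vectors). Woodward embedding $w$: let $x=(1,0)$, $y=(0,1)$, and $x(\mu)=(\mu^{r-1}x,\mu^{r-2}x,\dots,\mu x,x)$, $y(\mu)=(\mu^{r-1}y,\dots,\mu y,y)\in\mathbb{C}^{2r}$. For $A\in\mathcal{Y}(S^2,2r)$, a left eigenvector $v(\mu_i)$ (a nonzero row vector with $v(\mu_i)A=\mu_iv(\mu_i)$) has the form $v(\mu_i)=X(\mu_i)x(\mu_i)+Y(\mu_i)y(\mu_i)$ with $X(\mu_i),Y(\mu_i)\in\mathbb{C}$. Then $w(A)=(\mathcal{O}\oplus\mathcal{O},\ell_{p_1},\dots,\ell_{p_{2r}})$ with $\ell_{p_i}=[X(\mu_i):Y(\mu_i)]$. *)

(* Defs.v *)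
From HB Require Import structures.
From mathcomp Require Import all_boot all_order all_algebra.
From mathcomp Require Import all_classical all_reals.
From mathcomp Require Import topology normedtype sequences.
From mathcomp Require Import complex.

Set Implicit Arguments.
Unset Strict Implicit.
Unset Printing Implicit Defensive.

Import Order.TTheory GRing.Theory Num.Theory.
Import numFieldNormedType.Exports.

Local Open Scope classical_set_scope.
Local Open Scope ring_scope.

(* [R[i]] itself carries no canonical topology; seen as a numClosedFieldType
   it gets the one induced by its norm. *)
Definition Cx (R : realType) : numClosedFieldType := R[i].

(* [Some z] is [1 : z] and [None] is [0 : 1]. *)
Definition CP1 (R : realType) := option (Cx R).

Section ComplexLine.
Variable R : realType.
Local Notation C := (Cx R).
Local Notation P1 := (CP1 R).

(* A local coordinate t centered at x, as a parametrization t |-> chart x t: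
   t = z - a at [1 : a], and t = 1 / z at [0 : 1]. *)
Definition chart (x : P1) (t : C) : P1 :=
  match x with
  | Some a => Some (a + t)
  | None => if t == 0 then None else Some t^-1
  end.

Definition open_CP1 (A : set P1) : Prop :=
  forall x, A x -> \forall t \near (0 : C), A (chart x t).

(* Holomorphy in the sense of Weierstrass: on a neighbourhood of x, f is the
   sum of a convergent power series in the local coordinate. *)
Definition holomorphic_at (f : P1 -> C) (x : P1) : Prop :=
  exists a : nat -> C, \forall t \near (0 : C),
    series (fun n => a n * t ^+ n) @ \oo --> f (chart x t).

Definition mx_holomorphic_at m n (f : P1 -> 'M[C]_(m, n)) (x : P1) : Prop :=
  forall i j, holomorphic_at (fun y => f y i j) x.

Lemma mx_holomorphic_at_cst m n (M : 'M[C]_(m, n)) (f : P1 -> 'M[C]_(m, n)) x :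
  (forall y, f y = M) -> mx_holomorphic_at f x.
Proof.
move=> fM i j; exists (fun n => if n is 0 then M i j else 0).
apply: (@nearW _ (nbhs (0 : C))) => t; rewrite fM; apply: cvg_near_cst.
exists 1%N => // -[//|q] _ /=.
rewrite /series/= big_nat_recl// expr0 mulr1 big1 ?addr0// => k _.
by rewrite mul0r.
Qed.

(* Holomorphic vector bundles of rank k over CP^1.  The fiber over every point
   is the bare vector space C^k; the topology and the holomorphic structure are
   carried by the local frames only, and a frame need not depend on the point
   in any regular way when read in C^k.  [frame i y] maps coordinates in the
   i-th trivialization to vectors of the fiber over y, and is meaningful for
   y in [dom i] only.  Every holomorphic vector bundle is isomorphic to one of
   this form (choose a basis of each fiber). *)
Record bundle (k : nat) := Bundle {
  idx : Type;
  dom : idx -> set P1;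
  frame : idx -> P1 -> 'M[C]_k;
  dom_open : forall i, open_CP1 (dom i);
  dom_cover : forall x, exists i, dom i x;
  frame_unit : forall i x, dom i x -> frame i x \in unitmx;
  frame_holomorphic : forall i j x, dom i x -> dom j x ->
    mx_holomorphic_at (fun y => invmx (frame i y) *m frame j y) x
}.

Lemma trivial_bundle_open (i : unit) : open_CP1 [set: P1].
Proof. by move=> x _; apply: (@nearW _ (nbhs (0 : C))). Qed.

Lemma trivial_bundle_cover (x : P1) : exists i : unit, [set: P1] x.
Proof. by exists tt. Qed.

Lemma trivial_bundle_unit k (i : unit) (x : P1) :
  [set: P1] x -> (1%:M : 'M[C]_k) \in unitmx.
Proof. by move=> _; exact: unitmx1. Qed.

Lemma trivial_bundle_holomorphic k (i j : unit) (x : P1) :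
  [set: P1] x -> [set: P1] x ->
  mx_holomorphic_at (fun _ => invmx 1%:M *m 1%:M : 'M[C]_k) x.
Proof. by move=> _ _; apply: mx_holomorphic_at_cst. Qed.

Definition trivial_bundle (k : nat) : bundle k :=
  @Bundle k unit (fun _ => setT) (fun _ _ => 1%:M)
    trivial_bundle_open trivial_bundle_cover
    (@trivial_bundle_unit k) (@trivial_bundle_holomorphic k).

(* A bundle map F -> E acts on the fiber over y by [al y]. *)
Definition bundle_map k l (F : bundle k) (E : bundle l)
    (al : P1 -> 'M[C]_(l, k)) : Prop :=
  forall i j x, dom (b := E) i x -> dom (b := F) j x ->
    mx_holomorphic_at (fun y => invmx (frame i y) *m al y *m frame j y) x.

Definition bundle_iso k (F E : bundle k) (al : P1 -> 'M[C]_k) : Prop :=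
  bundle_map F E al /\ forall x, al x \in unitmx.

(* [s], a section of det E (whose fibers are C), has order m at x. *)
Definition has_det_order k (E : bundle k) (s : P1 -> C) (x : P1) (m : int) :
    Prop :=
  exists i, dom (b := E) i x /\ exists u, [/\ holomorphic_at u x, u x != 0 &
    \forall t \near (0 : C)^',
      (\det (frame i (chart x t)))^-1 * s (chart x t) = t ^ m * u (chart x t)].

(* The degree of E is that of its determinant line bundle, i.e. the degree of
   the divisor of a nonzero meromorphic section of det E. *)
Definition has_degree k (E : bundle k) (d : int) : Prop :=
  exists (s : P1 -> C) (m : P1 -> int),
    [/\ forall x, has_det_order E s x (m x),
        finite_set [set x | m x != 0] &
        d = \sum_(x \in [set: P1]) m x].

Definition line_subbundle (E : bundle 2) (L : bundle 1) (j : P1 -> 'M[C]_(2, 1)) :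
    Prop :=
  bundle_map L E j /\ forall x, j x != 0.

(* deg L <= deg E / 2 for all line subbundles L of E *)
Definition semistable (E : bundle 2) : Prop :=
  forall L j d e, line_subbundle E L j ->
    has_degree L d -> has_degree E e -> d *+ 2 <= e.

Definition local_frame k (E : bundle k) (x : P1) (g : P1 -> 'M[C]_k) : Prop :=
  (\forall t \near (0 : C), g (chart x t) \in unitmx) /\
  forall i, dom (b := E) i x ->
    mx_holomorphic_at (fun y => invmx (frame i y) *m g y) x.

Definition hvec (T : nmodType) (X Y : T) : 'cV[T]_2 := \col_i [:: X; Y]`_i.

(* The local coordinate at p is the one of [chart p]: another one differs from
   it by an invertible factor, which a change of local frame absorbs. *)
Definition hecke_modification (F E : bundle 2) (p : P1) (al : P1 -> 'M[C]_2) :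
    Prop :=
  [/\ bundle_map F E al,
      forall x, x <> p -> al x \in unitmx &
      exists f g, [/\ local_frame F p f, local_frame E p g &
        \forall t \near (0 : C),
          al (chart p t) *m f (chart p t) =
          g (chart p t) *m diag_mx (hvec 1 t)^T]].

(* [hs_map i] : E_{i+1} -> E_i is a Hecke modification at p_i; the points and
   the maps are indexed from 0 to n - 1. *)
Record hecke_seq n (p : 'I_n -> P1) := HeckeSeq {
  hs_bundle : 'I_n.+1 -> bundle 2;
  hs_map : 'I_n -> P1 -> 'M[C]_2;
  hs_bundle0 : hs_bundle ord0 = trivial_bundle 2;
  hs_hecke : forall i : 'I_n,
    hecke_modification (hs_bundle (lift ord0 i))
      (hs_bundle (widen_ord (leqnSn n) i)) (p i) (hs_map i)
}.

Definition hs_equiv n (p : 'I_n -> P1) (s s' : hecke_seq p) : Prop :=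
  exists ph : 'I_n.+1 -> P1 -> 'M[C]_2,
    [/\ forall x, ph ord0 x = 1%:M,
        forall i, bundle_iso (hs_bundle s i) (hs_bundle s' i) (ph i) &
        forall (i : 'I_n) x,
          ph (widen_ord (leqnSn n) i) x *m hs_map s i x =
          hs_map s' i x *m ph (lift ord0 i) x].

(* the composition of the first i + 1 maps of the sequence *)
Definition hs_comp n (p : 'I_n -> P1) (s : hecke_seq p) (i : 'I_n) (x : P1) :
    'M[C]_2 :=
  \prod_(j < n | (j <= i)%N) hs_map s j x.

(* the whole composition E_n -> E_0 *)
Definition hs_total n (p : 'I_n -> P1) (s : hecke_seq p) (x : P1) : 'M[C]_2 :=
  \prod_(j < n) hs_map s j x.

Definition kamnitzer_space n (p : 'I_n -> P1) : Type :=
  {c : set (hecke_seq p) |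
    exists2 s, semistable (hs_bundle s ord_max) & c = [set s' | hs_equiv s s']}.

(* Points of the projective line of lines in C^2. *)
Definition line := {l : {vspace 'cV[C]_2} | \dim l == 1%N}.

Definition lin_of_mx (M : 'M[C]_2) : 'End('cV[C]_2) :=
  linfun (mulmx M : 'cV[C]_2 -> 'cV[C]_2).

Definition semistable_lines n (l : 'I_n -> line) : Prop :=
  forall L : line, (#|[pred i | l i == L]|.*2 <= n)%N.

Definition Pss n : Type := {l : 'I_n -> line | semistable_lines l}.

Definition phi_mx : 'M[C]_2 :=
  \matrix_(i, j) (nth [::] [:: [:: 0; -1]; [:: 1; 0]] i)`_j.

Lemma phi_mx_unit : phi_mx \in unitmx.
Proof.
suff inv : phi_mx *m - phi_mx = 1%:M.
  have [u _] := mulmx1_unit inv.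
  exact: u.
apply/matrixP => i j; rewrite !mxE big_ord_recl big_ord1 !mxE.
case: i => [[|[|//]] hi]; case: j => [[|[|//]] hj]; rewrite /=.
- by rewrite mul0r add0r mulN1r opprK.
- by rewrite mul0r oppr0 mulr0 addr0.
- by rewrite oppr0 mulr0 mul0r addr0.
- by rewrite mul1r mul0r opprK addr0.
Qed.

Lemma lin_of_phi_inj : lker (lin_of_mx phi_mx) == 0%VS.
Proof.
apply/lker0P => u v; rewrite /lin_of_mx !lfunE.
exact: (can_inj (mulKmx phi_mx_unit)).
Qed.

Lemma phi_line_subproof (l : line) :
  \dim (lin_of_mx phi_mx @: val l)%VS == 1%N.
Proof.
by rewrite limg_dim_eq ?(valP l)// (eqP lin_of_phi_inj) capv0.
Qed.

Definition phi_line (l : line) : line :=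
  exist _ (lin_of_mx phi_mx @: val l)%VS (phi_line_subproof l).

Lemma phi_line_inj : injective phi_line.
Proof.
move=> l l' /(congr1 val) /= ll'; apply: val_inj => /=.
by apply/eqP; rewrite -(eq_limg_ker0 _ _ lin_of_phi_inj) ll'.
Qed.
Lemma phi_star_subproof n (l : Pss n) :
  semistable_lines (fun i => phi_line (sval l i)).
Proof.
case: l => l /= ssl L.
have [i /eqP <-|nL] := pickP (fun i => phi_line (l i) == L); last first.
  by rewrite (eq_card0 nL).
rewrite (_ : #|_| = #|[pred j | l j == l i]|); first exact: ssl.
by apply: eq_card => j; rewrite !inE (inj_eq phi_line_inj).
Qed.

Definition phi_star n (l : Pss n) : Pss n :=
  exist _ (fun i => phi_line (sval l i)) (phi_star_subproof l).

(* The maps of the commutative square are described by the predicates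
   [is_hecke_embedding], [is_kamnitzer_iso] and [is_woodward_embedding], each
   of which holds for at most one map; that the maps are well defined, with
   values in the stated spaces, amounts to the existence of such a map.
   Elements of [kamnitzer_space p] are equivalence classes, and a map on it is
   described by its values in terms of all representatives of a class. *)
Definition is_hecke_embedding n (p : 'I_n -> P1)
    (a : kamnitzer_space p -> Pss n) : Prop :=
  forall (h : kamnitzer_space p) (s : hecke_seq p), sval h s ->
    forall i, val (sval (a h) i) = limg (lin_of_mx (hs_comp s i (p i))).

Definition meromorphic_at (E : bundle 2) (sg : P1 -> 'cV[C]_2) (x : P1) : Prop :=
  forall i, dom (b := E) i x -> exists (N : nat) (tau : P1 -> 'cV[C]_2),
    mx_holomorphic_at tau x /\
    \forall t \near (0 : C)^',
      t ^+ N *: (invmx (frame i (chart x t)) *m sg (chart x t)) =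
      tau (chart x t).

(* Algebraic sections of E over U = {[1 : z]}: the holomorphic sections over U
   that are meromorphic at the point at infinity.  The value of [sg] at
   infinity is irrelevant. *)
Definition algebraic_section (E : bundle 2) (sg : P1 -> 'cV[C]_2) : Prop :=
  (forall z i, dom (b := E) i (Some z) ->
    mx_holomorphic_at (fun y => invmx (frame i y) *m sg y) (Some z)) /\
  meromorphic_at E sg None.

(* The image in L_0 = C[z] e^1 + C[z] e^2 of the module L_n of algebraic
   sections of E_n over U. *)
Definition image_L n (p : 'I_n -> P1) (s : hecke_seq p) :
    set 'cV[{poly C}]_2 :=
  [set f | exists2 sg, algebraic_section (hs_bundle s ord_max) sg &
    forall z : C,
      map_mx (horner_eval z) f = hs_total s (Some z) *m sg (Some z)].

(* z^(r-1) e^1, z^(r-1) e^2, ..., z e^1, z e^2, e^1, e^2, indexed from 0 *)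
Definition kbasis r (k : 'I_(2 * r)) : 'cV[{poly C}]_2 :=
  'X^(r.-1 - k./2) *: (if odd k then hvec 0 1 else hvec 1 0).

(* (b k) is a basis of the complex vector space L_0 / W. *)
Definition is_basis_mod (W : set 'cV[{poly C}]_2) m
    (b : 'I_m -> 'cV[{poly C}]_2) : Prop :=
  forall f, exists! c : 'cV[C]_m, W (f - \sum_k (c k 0)%:P *: b k).

(* A is the matrix, in the basis (b k) of L_0 / W, of multiplication by z. *)
Definition is_mulz_matrix (W : set 'cV[{poly C}]_2) m
    (b : 'I_m -> 'cV[{poly C}]_2) (A : 'M[C]_m) : Prop :=
  forall l, W ('X *: b l - \sum_k (A k l)%:P *: b k).

(* For 2x2 blocks, the block of index k is k./2: the entries outside the left
   block column are those of identity blocks on the block superdiagonal. *)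
Definition seidel_smith_slice r (A : 'M[C]_(2 * r)) : Prop :=
  forall k l : 'I_(2 * r), (2 <= l)%N -> A k l = (k.+2 == l :> nat)%:R.

Definition seidel_smith r (mu : 'I_(2 * r) -> C) : Type :=
  {A : 'M[C]_(2 * r) |
    seidel_smith_slice A /\ char_poly A = \prod_i ('X - (mu i)%:P)}.

Definition is_kamnitzer_iso r (mu : 'I_(2 * r) -> C)
    (K : kamnitzer_space (fun i => Some (mu i)) -> seidel_smith mu) : Prop :=
  forall h s, sval h s ->
    is_basis_mod (image_L s) (@kbasis r) /\
    is_mulz_matrix (image_L s) (@kbasis r) (sval (K h)).

Definition wvec r (m : C) (e : 'rV[C]_2) : 'rV[C]_(2 * r) :=
  \row_k (m ^+ (r.-1 - k./2) * e 0 (inord (odd k))).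

Definition xvec r (m : C) : 'rV[C]_(2 * r) := wvec r m (hvec 1 0)^T.
Definition yvec r (m : C) : 'rV[C]_(2 * r) := wvec r m (hvec 0 1)^T.

Definition is_woodward_embedding r (mu : 'I_(2 * r) -> C)
    (w : seidel_smith mu -> Pss (2 * r)) : Prop :=
  forall (A : seidel_smith mu) i (v : 'rV[C]_(2 * r)),
    v != 0 -> v *m sval A = mu i *: v ->
    exists X Y, v = X *: xvec r (mu i) + Y *: yvec r (mu i) /\
      val (sval (w A) i) = <[hvec X Y]>%VS.

End ComplexLine.

Arguments phi_star {R n} l.

(* Main.v *)
Require Import Defs.
From mathcomp Require Import all_boot all_order all_algebra.
From mathcomp Require Import all_classical all_reals.
From mathcomp Require Import topology normedtype sequences.
From mathcomp Require Import complex.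
From mathcomp Require Import ring zify.

(** The idea is to replace the bundles by lines in the plane.  Let alpha be the
    composite map E_n -> E_0, n = 2 r.  The points p_i being distinct, alpha is
    invertible away from them and reads P(t) diag(1, t) Q(t) near p_i, with P and Q
    invertible and holomorphic.  Hence, for a vector f of polynomials, the equation
    alpha s = f has an algebraic solution s over the affine part iff f(mu_i) lies in
    the line l_i = im alpha(p_i) for all i ([image_LE]), and l_i is the line of the
    Hecke embedding.

    Semistability of E_n is used once, in [semistable_degree]: a nonzero f with
    f(mu_i) in l_i for all i has degree at least r.  For f of minimal degree d, the
    section s with alpha s = f vanishes nowhere on the affine part, since it could
    otherwise be divided by some z - z0; so s spans a line subbundle O(-d) of E_n,
    and deg E_n = -n because det alpha has n simple zeros.

    Let u_i = phi (g_i), where g_i spans l_i.  As phi (a, b) = (-b, a), the equation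
    of l_i is u_i . v = 0.  In the basis (z^(r-1) e^1, ..., e^2), the map
    f |-> (u_i . f(mu_i))_i on vectors of polynomials of degree < r is the square
    matrix N with rows X_i x(mu_i) + Y_i y(mu_i), (X_i, Y_i) = u_i ([wvec_mx]), and
    the previous paragraph says that N is invertible.  Everything follows from this.
    The vectors z^k e^j, k < r, form a basis of L_0 modulo the image of L_n, and
    the matrix of multiplication by z is N^-1 diag(mu) N; so the rows of N are its
    left eigenvectors, from which the Woodward embedding reads u_i = phi (g_i).  And at
    most r of the u_i are proportional, because the corresponding rows of N are
    independent in a space of dimension r ([wvec_mx_semistable]).  The same count
    applies to the eigenvectors of any matrix of the slice with eigenvalues mu_i.

    Holomorphy being a condition on one power series at each point, the analysis
    reduces to germs at 0: they form a ring in which a germ that does not vanish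
    at 0 is invertible ([hol_mul], [hol_inv]), and one that vanishes at 0 is
    divisible by t ([hol_divX]). *)

Set Implicit Arguments.
Unset Strict Implicit.
Unset Printing Implicit Defensive.

Import Order.TTheory GRing.Theory Num.Theory.
Import numFieldNormedType.Exports.

Local Open Scope classical_set_scope.
Local Open Scope ring_scope.

(** * Germs of holomorphic functions at the origin *)

Section Germs.
Variable C : numFieldType.
Implicit Types (f g : C -> C) (t : C).

(** [u k] is the k-th tail (f - sum_(n < k) a_n t^n) / t^k of a power series with
    coefficients a_n = u n 0.  Geometric bounds on the tails are equivalent to
    convergence near 0, and unlike convergence they pass to products and inverses
    by finite computations, so that no completeness of the field is involved. *)
Definition tails f (u : nat -> C -> C) (K M : C) :=
  [/\ 0 < K, 0 < M & \forall t \near (0 : C), u 0 t = f t /\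
    forall k, u k t = u k 0 + t * u k.+1 t /\ `|u k t| <= K * M ^+ k].

Definition hol f := exists u K M, tails f u K M.

Lemma near0_lt (e : C) : 0 < e -> \forall t \near (0 : C), `|t| < e.
Proof. by move=> e0; apply: nbhs0_lt. Qed.

Lemma near0W (P : C -> Prop) : (forall t, P t) -> \forall t \near (0 : C), P t.
Proof. by move=> h; apply: (@nearW _ (nbhs (0 : C))). Qed.

Lemma near0_half (M : C) : 0 < M -> \forall t \near (0 : C), M * `|t| <= 2^-1.
Proof.
move=> M0; have := @near0_lt (M^-1 * 2^-1) _.
move=> /(_ (mulr_gt0 _ _)); rewrite !invr_gt0 ltr0n M0 => /(_ isT isT).
apply: filterS => t /ltW; by rewrite -ler_pdivlMl.
Qed.

(** The k-th remainder of the series is t^k u_k, of norm at most K (M |t|)^k.  That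
    2^-n tends to 0 has to be assumed, since a numFieldType may be non-archimedean. *)
Lemma power_series_of_hol f :
    (forall K : C, 0 <= K -> (fun n => K * 2^-1 ^+ n) @ \oo --> (0 : C)) ->
  hol f -> exists a : nat -> C,
  \forall t \near (0 : C), series (fun n => a n * t ^+ n) @ \oo --> f t.
Proof.
move=> cvg_half [u [K [M [K0 M0 hu]]]].
exists (fun k => u k 0).
near=> t; apply/cvgrPdist_le => e e0.
have [hf ht] : u 0 t = f t /\
  forall k, u k t = u k 0 + t * u k.+1 t /\ `|u k t| <= K * M ^+ k by near: t.
have Mt : M * `|t| <= 2^-1 by near: t; exact: near0_half.
have eqN N : f t - series (fun n => u n 0 * t ^+ n) N = t ^+ N * u N t.
  elim: N => [|N IH]; first by rewrite /series /= big_geq// subr0 mul1r hf.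
  rewrite /series /= big_nat_recr//= opprD addrA IH (ht N).1 exprSr; ring.
have /cvgrPdist_le /(_ _ e0) := cvg_half _ (ltW K0).
apply: filterS => N; rewrite sub0r normrN eqN.
have p : 0 <= K * 2^-1 ^+ N by rewrite mulr_ge0 ?exprn_ge0 ?invr_ge0 ?ler0n// ltW.
rewrite ger0_norm// => hN; apply: le_trans hN; rewrite normrM normrX.
apply: le_trans (_ : `|t| ^+ N * (K * M ^+ N) <= _).
  by rewrite ler_wpM2l ?exprn_ge0//; have [] := ht N.
rewrite mulrCA ler_pM2l// mulrC -exprMn lerXn2r// nnegrE ?invr_ge0//.
by rewrite mulr_ge0// ltW.
Unshelve. all: by end_near.
Qed.

(** Convergence at a single t0 <> 0 bounds a_n by K / t0^n; summing the geometric
    series then bounds the tails at all t with |t| <= t0 / 2. *)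
Lemma hol_of_power_series f (a : nat -> C) :
  (\forall t \near (0 : C), series (fun n => a n * t ^+ n) @ \oo --> f t) ->
  hol f.
Proof.
move=> ha.
have [e e0 he] := (nbhs_ballP _ _).1 ha.
have e20 : 0 < e / 2 by rewrite divr_gt0.
pose t0 : C := e / 2.
have ct0 : cvgn (series (fun n => a n * t0 ^+ n)).
  apply: cvgP; apply: he; rewrite -ball_normE /= sub0r normrN gtr0_norm//.
  by rewrite ltr_pdivrMr// ltr_pMr// ltr1n.
have [K K0 hK] : exists2 K : C, 0 < K & forall n, `|a n| <= K * t0^-1 ^+ n.
  have /cvgP := cvg_series_cvg_0 ct0 => /cvg_seq_bounded.
  move=> [K [Kr hK]]; exists (`|K| + 1); first by rewrite ltr_pwDr.
  move=> n; have := hK (`|K| + 1) => /(_ _ n I) hn.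
  rewrite exprVn ler_pdivlMr ?exprn_gt0// -(gtr0_norm (e20 : 0 < t0)) -normrX -normrM.
  by apply: hn; rewrite (le_lt_trans (real_ler_norm Kr))// ltrDl.
pose M := t0^-1.
have M0 : 0 < M by rewrite invr_gt0.
pose A N t := series (fun n => a n * t ^+ n) N.
pose u k t := if t == 0 then a k else (f t - A k t) / t ^+ k.
have a0 k : u k 0 = a k by rewrite /u eqxx.
have f0 : f 0 = a 0%N.
  have h : series (fun n => a n * 0 ^+ n) @ \oo --> f 0 := nbhs_singleton ha.
  apply: (cvg_unique _ h); first exact: norm_hausdorff.
  apply: cvg_near_cst; exists 1%N => // -[//|n] _ /=.
  rewrite /series /= big_nat_recl// expr0 mulr1 big1 ?addr0// => i _.
  by rewrite expr0n mulr0.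
have tail_le m k t : M * `|t| <= 2^-1 -> (k <= m)%N ->
    `|A m t - A k t| <= K * 2 * (M * `|t|) ^+ k * (1 - 2^-1 ^+ (m - k)).
  move=> Mt; have q0 : 0 <= M * `|t| by rewrite mulr_ge0// ltW.
  elim: m => [|m IH].
    by rewrite leqn0 => /eqP->; rewrite subrr normr0 expr0 subrr mulr0.
  rewrite leq_eqVlt => /predU1P[<-|].
    by rewrite subrr subnn normr0 expr0 subrr mulr0.
  rewrite ltnS => km; rewrite {1}/A /series /= big_nat_recr//= addrAC.
  apply: le_trans (ler_normD _ _) _.
  apply: le_trans (lerD (IH km) (_ : _ <= K * (M * `|t|) ^+ k * 2^-1 ^+ (m - k))) _.
    rewrite normrM normrX; apply: le_trans (ler_wpM2r _ (hK m)) _.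
      exact: exprn_ge0.
    rewrite -!mulrA ler_pM2l// -exprMn -{1}(subnKC km) exprD ler_wpM2l ?exprn_ge0//.
    by rewrite lerXn2r// nnegrE ?invr_ge0.
  rewrite subSn// exprS le_eqVlt; apply/orP; left; apply/eqP.
  by field.
exists u, (K * 2), M; split=> //; first by rewrite mulr_gt0.
near=> t; split.
  rewrite /u; case: eqP => [->//|_]; by rewrite /A /series /= big_geq// subr0 divr1.
move=> k; split.
  rewrite a0 /u; case: eqP => [->|/eqP t1]; first by rewrite mul0r addr0.
  rewrite /A {2}/series /= big_nat_recr//= -/(series _ k) exprSr.
  by rewrite [series _ _]/series /=; field; rewrite t1 expf_neq0.
have Mt : M * `|t| <= 2^-1 by near: t; exact: near0_half.
have q0 : 0 <= M * `|t| by rewrite mulr_ge0// ltW.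
have cvt : series (fun n => a n * t ^+ n) @ \oo --> f t by near: t.
rewrite /u; case: eqP => [_|/eqP tn0].
  apply: le_trans (hK k) _; rewrite -/M ler_wpM2r ?exprn_ge0 ?(ltW M0)//.
  by rewrite ler_peMr ?ler1n// ltW.
rewrite normrM normfV normrX ler_pdivrMr ?exprn_gt0 ?normr_gt0//.
rewrite -mulrA -exprMn.
set B := K * 2 * _.
have B0 : 0 <= B by rewrite !mulr_ge0 ?exprn_ge0// ltW.
rewrite real_leNgt ?normr_real ?ger0_real//; apply/negP => lt.
have /cvgrPdist_lt cvt' := cvt; have := cvt' (`|f t - A k t| - B).
rewrite subr_gt0 => /(_ lt) [N _ hN].
have := hN (maxn N k) (leq_maxl _ _); rewrite /= -/(A _ _).
suff le : `|f t - A k t| - B <= `|f t - A (maxn N k) t|.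
  by move=> /(le_lt_trans le); rewrite ltxx.
rewrite lerBlDr -(subrKA (A (maxn N k) t)); apply: le_trans (ler_normD _ _) _.
rewrite lerD2l; apply: le_trans (tail_le _ _ _ Mt (leq_maxr _ _)) _.
by rewrite ler_piMr// lerBlDr lerDl exprn_ge0// invr_ge0.
Unshelve. all: by end_near.
Qed.
Lemma near_eq_hol f g : (\forall t \near (0 : C), f t = g t) -> hol f -> hol g.
Proof.
move=> fg [u [K [M [K0 M0 h]]]]; exists u, K, M; split=> //.
by apply: filterS2 fg h => t -> [-> ].
Qed.

Lemma hol_cst (c : C) : hol (fun=> c).
Proof.
exists (fun k _ => if k is 0 then c else 0), (`|c| + 1), 1.
split; [by rewrite ltr_wpDl| by []|].
apply: near0W => t; split=> // k; rewrite mulr0 addr0 expr1n mulr1; split=> //.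
by case: k => [|k]; rewrite ?normr0 ?lerDl ?addr_ge0.
Qed.

Lemma hol_id : hol (fun t => t).
Proof.
exists (fun k t => match k with 0 => t | 1 => 1 | _ => 0 end), 1, 1.
split; [by []| by []|].
apply: filterS (near0_lt ltr01) => t t1; split=> // k.
rewrite expr1n mulr1.
by case: k => [|[|k]]; rewrite ?mulr1 ?mulr0 ?add0r ?addr0 ?normr1 ?normr0// (ltW t1).
Qed.

Lemma hol_bound_le (K K' M M' : C) k : 0 < K -> 0 < M -> K <= K' -> M <= M' ->
  K * M ^+ k <= K' * M' ^+ k.
Proof.
move=> K0 M0 KK MM; apply: ler_pM => //; rewrite ?exprn_ge0// ?(ltW K0) ?(ltW M0)//.
by apply: lerXn2r; rewrite ?nnegrE// ltW// (lt_le_trans M0).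
Qed.

Lemma hol_add f g : hol f -> hol g -> hol (fun t => f t + g t).
Proof.
move=> [u [K [M [K0 M0 hu]]]] [v [L [N [L0 N0 hv]]]].
have MN : 0 < M + N by rewrite addr_gt0.
exists (fun k t => u k t + v k t), (K + L), (M + N); split; rewrite ?addr_gt0//.
apply: filterS2 hu hv => t [<- hu] [<- hv]; split=> // k.
have [ue ub] := hu k; have [ve vb] := hv k; split.
  by rewrite ue ve; ring.
apply: le_trans (ler_normD _ _) _; rewrite mulrDl lerD//.
  by apply: le_trans ub _; apply: hol_bound_le; rewrite // lerDl ltW.
by apply: le_trans vb _; apply: hol_bound_le; rewrite // lerDr ltW.
Qed.

(** The k-th tail of a product is sum_(i < k) a_i v_(k-i) + u_k v_0: the terms of
    index i < k of the first series are multiplied by tails of the second one.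
    The number of terms is absorbed in 2^k. *)
Lemma hol_mul f g : hol f -> hol g -> hol (fun t => f t * g t).
Proof.
move=> [u [K [M [K0 M0 hu]]]] [v [L [N [L0 N0 hv]]]].
pose w k t := \sum_(i < k) u i 0 * v (k - i)%N t + u k t * v 0%N t.
have MN : 0 < M + N by rewrite addr_gt0.
have ule t k : `|u k t| <= K * M ^+ k -> `|u k t| <= K * (M + N) ^+ k.
  by move=> /le_trans; apply; apply: hol_bound_le; rewrite // lerDl ltW.
have vle t k : `|v k t| <= L * N ^+ k -> `|v k t| <= L * (M + N) ^+ k.
  by move=> /le_trans; apply; apply: hol_bound_le; rewrite // lerDr ltW.
exists w, (K * L), (2 * (M + N)); split; rewrite ?mulr_gt0//.
have [_ hu0] := nbhs_singleton hu; have [_ hv0] := nbhs_singleton hv.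
have w0 k : w k 0 = \sum_(i < k.+1) u i 0 * v (k - i)%N 0.
  by rewrite /w big_ord_recr /= subnn.
apply: filterS2 hu hv => t [<- {}hu] [<- {}hv]; split=> [|k].
  by rewrite /w big_ord0 add0r.
split.
  rewrite w0 /w !(big_ord_recr k) /= subnn subSnn.
  have -> : \sum_(i < k) u i 0 * v (k - i)%N t = \sum_(i < k) u i 0 * v (k - i)%N 0 +
      t * \sum_(i < k) u i 0 * v (k.+1 - i)%N t.
    rewrite mulr_sumr -big_split; apply: eq_bigr => i _ /=.
    rewrite (hv (k - i)%N).1 subSn ?(ltnW (ltn_ord i))//; ring.
  by rewrite (hu k).1 (hv 0%N).1; ring.
have ui i s : `|u i s| <= K * M ^+ i -> forall j s', `|v j s'| <= L * N ^+ j ->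
    `|u i s * v j s'| <= K * L * (M + N) ^+ (i + j).
  move=> /ule ui j s' /vle vj; rewrite normrM exprD mulrACA.
  by apply: ler_pM.
apply: le_trans (_ : (k.+1)%:R * (K * L * (M + N) ^+ k) <= _).
  rewrite /w -natr1 mulrDl mul1r; apply: le_trans (ler_normD _ _) _.
  apply: lerD; last first.
    rewrite -{2}(addn0 k); have [_ uk] := hu k; have [_ vk] := hv 0%N.
    exact: (ui k t uk 0%N t vk).
  apply: le_trans (ler_norm_sum _ _ _) _.
  rewrite -[X in X%:R](card_ord k) -sumr_const mulr_suml; apply: ler_sum => i _.
  rewrite mul1r.
  have [_ uk] := hu0 i; have [_ vk] := hv (k - i)%N.
  by have := ui i 0 uk _ t vk; rewrite subnKC // ltnW.
rewrite exprMn mulrCA ler_wpM2l ?mulr_ge0 ?(ltW K0) ?(ltW L0)//.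
rewrite ler_wpM2r ?exprn_ge0 ?(ltW MN)// -natrX ler_nat.
exact: ltn_expl.
Qed.

Lemma hol_sum (I : Type) (r : seq I) (P : pred I) (F : I -> C -> C) :
  (forall i, P i -> hol (F i)) -> hol (fun t => \sum_(i <- r | P i) F i t).
Proof.
move=> h; elim: r => [|i r IH].
  by apply: near_eq_hol (hol_cst 0); apply: near0W => t; rewrite big_nil.
case: (boolP (P i)) => Pi.
  apply: near_eq_hol (hol_add (h i Pi) IH); apply: near0W => t.
  by rewrite big_cons Pi.
by apply: near_eq_hol IH; apply: near0W => t; rewrite big_cons (negbTE Pi).
Qed.

Lemma hol_prod (I : Type) (r : seq I) (P : pred I) (F : I -> C -> C) :
  (forall i, P i -> hol (F i)) -> hol (fun t => \prod_(i <- r | P i) F i t).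
Proof.
move=> h; elim: r => [|i r IH].
  by apply: near_eq_hol (hol_cst 1); apply: near0W => t; rewrite big_nil.
case: (boolP (P i)) => Pi.
  apply: near_eq_hol (hol_mul (h i Pi) IH); apply: near0W => t.
  by rewrite big_cons Pi.
by apply: near_eq_hol IH; apply: near0W => t; rewrite big_cons (negbTE Pi).
Qed.

Lemma hol_exp f n : hol f -> hol (fun t => f t ^+ n).
Proof.
move=> h; have := @hol_prod 'I_n (index_enum _) xpredT (fun _ => f) (fun _ _ => h).
by apply: near_eq_hol; apply: near0W => t; rewrite prodr_const card_ord.
Qed.

Lemma hol_poly (p : {poly C}) f : hol f -> hol (fun t => p.[f t]).
Proof.
move=> h; apply: (@near_eq_hol (fun t => \sum_(i < size p) p`_i * f t ^+ i)).
  by apply: near0W => t; rewrite horner_coef.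
by apply: hol_sum => i _; apply: hol_mul (hol_cst _) (hol_exp _ h).
Qed.

(** The first tail is the quotient. *)
Lemma hol_divX f : hol f -> f 0 = 0 ->
  exists2 g, hol g & \forall t \near (0 : C), f t = t * g t.
Proof.
move=> [u [K [M [K0 M0 hu]]]] f0; exists (u 1%N).
  exists (fun k => u k.+1), (K * M), M; split; rewrite ?mulr_gt0//.
  apply: filterS hu => t [_ hu]; split=> // k; split; first by have [] := hu k.+1.
  by rewrite -mulrA -exprS; have [] := hu k.+1.
have [u00 _] := nbhs_singleton hu.
by apply: filterS hu => t [<- /(_ 0%N) [e _]]; rewrite e u00 f0 add0r.
Qed.

Lemma hol_near_norm f (e : C) : hol f -> 0 < e ->
  \forall t \near (0 : C), `|f t - f 0| <= e.
Proof.
move=> [u [K [M [K0 M0 hu]]]] e0.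
have [u00 _] := nbhs_singleton hu.
have KM : 0 < K * M by rewrite mulr_gt0.
apply: filterS2 hu (near0_lt (divr_gt0 e0 KM)) => t [<- hu] /ltW te.
rewrite (hu 0%N).1 u00 addrAC subrr add0r normrM.
apply: le_trans (_ : e / (K * M) * (K * M) <= _); last by rewrite divfK ?gt_eqF.
by apply: ler_pM => //; have [_] := hu 1%N.
Qed.

Lemma hol_near_neq0 f : hol f -> f 0 != 0 -> \forall t \near (0 : C),
  `|f 0| / 2 <= `|f t|.
Proof.
move=> hf f0; have e0 : 0 < `|f 0| / 2 by rewrite divr_gt0 ?normr_gt0.
apply: filterS (hol_near_norm hf e0) => t.
rewrite distrC => h; rewrite -(lerD2l (`|f 0| / 2)) -splitr.
rewrite -{1}(subrK (f t) (f 0)); apply: le_trans (ler_normD _ _) _.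
by rewrite lerD2r.
Qed.

(** This is mere continuity at 0.  It extends to the centre an identity that is
    known where the coordinate can be divided out. *)
Lemma hol_eq0 f : hol f -> (\forall t \near (0 : C)^', f t = 0) -> f 0 = 0.
Proof.
move=> hf f0; apply/eqP; apply: contraT => n0.
have h : \forall t \near (0 : C)^', `|f 0| / 2 <= `|f t|.
  by apply: cvg_within; exact: hol_near_neq0.
have [t []] := @filter_ex _ _ _ _ (filterI f0 h).
have pos : 0 < `|f 0| / 2 by rewrite divr_gt0 ?normr_gt0.
by move=> ->; rewrite normr0 => /(lt_le_trans pos); rewrite ltxx.
Qed.

(** The coefficients c_n of 1 / f are found recursively from f * (1 / f) = 1, and the
    k-th tail of 1 / f is - (1 / f) sum_(i < k) c_i u_(k-i).  If 1 / |f| <= L near 0,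
    induction bounds it by L (M (1 + L K))^k. *)
Lemma hol_inv f : hol f -> f 0 != 0 -> hol (fun t => (f t)^-1).
Proof.
move=> hf f0; have hf0 := hol_near_neq0 hf f0.
case: hf => [u [K [M [K0 M0 hu]]]].
pose L := (`|f 0| / 2)^-1.
have L0 : 0 < L by rewrite invr_gt0 divr_gt0 ?normr_gt0.
have [u00 hu0] := nbhs_singleton hu.
have [c cE] : exists c : nat -> C, forall n, c n =
    if n is 0 then (f 0)^-1 else - (f 0)^-1 * \sum_(i < n) c i * u (n - i)%N 0.
  (* course-of-values recursion: cs n lists the first n coefficients *)
  pose F := fun n (r : seq C) => if n is 0 then (f 0)^-1 else
     - (f 0)^-1 * \sum_(i < n) r`_i * u (n - i)%N 0.
  pose cs := fix cs n := if n is m.+1 then rcons (cs m) (F m (cs m)) else [::].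
  have sz n : size (cs n) = n by elim: n => //= n IH; rewrite size_rcons IH.
  have csn m n : (m < n)%N -> (cs n)`_m = F m (cs m).
    elim: n => // n IH; rewrite ltnS leq_eqVlt => /predU1P[<-|mn] /=.
      by rewrite nth_rcons sz ltnn eqxx.
    by rewrite nth_rcons sz mn IH.
  exists (fun n => F n (cs n)) => -[//|n]; rewrite {1}/F; congr (_ * _).
  by apply: eq_bigr => i _; rewrite csn.
pose h n t := if n is 0 then (f t)^-1 else
  - (f t)^-1 * \sum_(i < n) c i * u (n - i)%N t.
have h0 n : h n 0 = c n by rewrite cE /h; case: n.
pose Q := 1 + L * K.
have Q0 : 0 < Q by rewrite ltr_wpDr ?mulr_ge0 ?(ltW L0) ?(ltW K0).
have cle n : (`|c n| <= L * (M * Q) ^+ n) /\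
   (forall t, `|f t|^-1 <= L -> (forall k, `|u k t| <= K * M ^+ k) ->
     `|h n t| <= L * (M * Q) ^+ n).
  have fL : `|f 0|^-1 <= L.
    rewrite lef_pV2 ?posrE ?normr_gt0 ?divr_gt0 ?normr_gt0//.
    by rewrite ler_pdivrMr// ler_peMr// ler1n.
  have uK k : `|u k 0| <= K * M ^+ k by have [] := hu0 k.
  suff main : forall t, `|f t|^-1 <= L -> (forall k, `|u k t| <= K * M ^+ k) ->
     `|h n t| <= L * (M * Q) ^+ n.
    by split=> //; rewrite -h0; apply: main.
  elim/ltn_ind: n => n IH t ft ut; case: n IH => [|n] IH.
    by rewrite /h mulr1 normfV.
  rewrite /h normrM normrN normfV; apply: ler_pM => //; first by rewrite invr_ge0.
  apply: le_trans (ler_norm_sum _ _ _) _.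
  apply: le_trans (_ : \sum_(i < n.+1) (M ^+ n.+1 * (L * K)) * Q ^+ i <= _).
    apply: ler_sum => i _; rewrite normrM.
    have ci := IH i (ltn_ord i) 0 fL uK; rewrite h0 in ci.
    apply: le_trans (ler_pM _ _ ci (ut _)) _ => //.
    have -> : M ^+ n.+1 = M ^+ i * M ^+ (n.+1 - i) by rewrite -exprD subnKC// ltnW.
    by rewrite exprMn le_eqVlt; apply/orP; left; apply/eqP; ring.
  rewrite -mulr_sumr exprMn -mulrA ler_pM2l ?exprn_gt0//.
  have -> : L * K = Q - 1 by rewrite /Q addrC addKr.
  by rewrite -subrX1 lerBlDr lerDl.
exists h, L, (M * Q); split; rewrite ?mulr_gt0//.
apply: filterS2 hu hf0 => t [ut0 ut] ft; split=> // k.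
have ftn0 : f t != 0.
  by rewrite -normr_gt0 (lt_le_trans _ ft)// divr_gt0 ?normr_gt0.
split; last first.
  apply: (cle k).2; last by move=> j; have [] := ut j.
  by rewrite lef_pV2 ?posrE ?normr_gt0 ?divr_gt0 ?normr_gt0.
rewrite h0.
have key n : f t * h n.+1 t = - \sum_(i < n.+1) c i * u (n.+1 - i)%N t.
  by rewrite /h mulrA mulrN mulfV// mulN1r.
apply: (mulfI ftn0); rewrite /= [RHS]mulrDr mulrCA key.
have f0E : f t = f 0 + t * u 1%N t by rewrite -ut0 (ut 0%N).1 u00.
case: k => [|k].
  by rewrite /h mulfV// big_ord1 cE subn0 f0E; field.
rewrite key [in RHS]big_ord_recr /= subSnn f0E.
have ck : f 0 * c k.+1 = - \sum_(i < k.+1) c i * u (k.+1 - i)%N 0.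
  by rewrite {1}cE mulrA mulrN mulfV// mulN1r.
have -> : \sum_(i < k.+1) c i * u (k.+1 - i)%N t =
    \sum_(i < k.+1) c i * u (k.+1 - i)%N 0 +
    t * \sum_(i < k.+1) c i * u (k.+2 - i)%N t.
  rewrite mulr_sumr -big_split; apply: eq_bigr => i _ /=.
  rewrite (ut (k.+1 - i)%N).1 (subSn (ltnW (ltn_ord i))); ring.
by rewrite mulrDl ck; ring.
Qed.

Lemma cvg_geometric_half : (forall K : C, 0 <= K -> exists N : nat, K <= N%:R) ->
  forall K : C, 0 <= K -> (fun n => K * 2^-1 ^+ n) @ \oo --> (0 : C).
Proof.
move=> arch K K0; apply/cvgrPdist_le => e e0.
have [N] := arch (K / e) (divr_ge0 K0 (ltW e0)); rewrite ler_pdivrMr// => hN.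
exists N => // n /= Nn.
have pos : 0 <= K * 2^-1 ^+ n by rewrite mulr_ge0 ?exprn_ge0 ?invr_ge0 ?ler0n.
rewrite sub0r normrN ger0_norm // exprVn ler_pdivrMr ?exprn_gt0 ?ltr0n//.
apply: le_trans hN _; rewrite mulrC ler_pM2l// -natrX ler_nat.
exact: leq_trans Nn (ltnW (ltn_expl _ _)).
Qed.

End Germs.

(** * Matrix germs and their local normal forms *)

Section MatrixGerms.
Variable C : numFieldType.

Definition mxhol m n (A : C -> 'M[C]_(m, n)) := forall i j, hol (fun t => A t i j).

Lemma near_eq_mxhol m n (A B : C -> 'M[C]_(m, n)) :
  (\forall t \near (0 : C), A t = B t) -> mxhol A -> mxhol B.
Proof.
move=> AB hA i j; apply: near_eq_hol (hA i j).
by apply: filterS AB => t ->.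
Qed.

Lemma mxhol_cst m n (A : 'M[C]_(m, n)) : mxhol (fun=> A).
Proof. by move=> i j; apply: hol_cst. Qed.

Lemma mxhol_mul m n p (A : C -> 'M[C]_(m, n)) (B : C -> 'M[C]_(n, p)) :
  mxhol A -> mxhol B -> mxhol (fun t => A t *m B t).
Proof.
move=> hA hB i j; apply: (@near_eq_hol _ (fun t => \sum_k A t i k * B t k j)).
  by apply: near0W => t; rewrite mxE.
by apply: hol_sum => k _; apply: hol_mul.
Qed.

Lemma mxhol_scale m n (f : C -> C) (A : C -> 'M[C]_(m, n)) :
  hol f -> mxhol A -> mxhol (fun t => f t *: A t).
Proof.
move=> hf hA i j; apply: near_eq_hol (hol_mul hf (hA i j)).
by apply: near0W => t; rewrite mxE.
Qed.

Lemma hol_det n (A : C -> 'M[C]_n) : mxhol A -> hol (fun t => \det (A t)).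
Proof.
move=> hA; rewrite /determinant; apply: hol_sum => s _.
by apply: hol_mul (hol_cst _) (hol_prod _ _) => i _; apply: hA.
Qed.

Lemma mxhol_eq0 m n (A : C -> 'M[C]_(m, n)) :
  mxhol A -> (\forall t \near (0 : C)^', A t = 0) -> A 0 = 0.
Proof.
move=> hA A0; apply/matrixP => i j; rewrite mxE.
apply: (hol_eq0 (hA i j)); apply: filterS A0 => t ->; by rewrite mxE.
Qed.

Definition unit_germ n (A : C -> 'M[C]_n) := mxhol A /\ A 0 \in unitmx.

Lemma near_unit_germ n (A : C -> 'M[C]_n) : unit_germ A ->
  \forall t \near (0 : C), A t \in unitmx.
Proof.
move=> [hA]; rewrite unitmxE unitfE => dA.
apply: filterS (hol_near_neq0 (hol_det hA) dA) => t h.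
by rewrite unitmxE unitfE -normr_gt0 (lt_le_trans _ h)// divr_gt0 ?normr_gt0.
Qed.

Lemma near_eq_unit_germ n (A B : C -> 'M[C]_n) :
  (\forall t \near (0 : C), A t = B t) -> unit_germ A -> unit_germ B.
Proof.
move=> AB [hA uA]; split; first exact: near_eq_mxhol hA.
by rewrite -(nbhs_singleton AB).
Qed.

Lemma unit_germ1 n : unit_germ (fun _ => 1%:M : 'M[C]_n).
Proof. by split; [apply: mxhol_cst|apply: unitmx1]. Qed.

Lemma unit_germ_mul n (A B : C -> 'M[C]_n) :
  unit_germ A -> unit_germ B -> unit_germ (fun t => A t *m B t).
Proof.
move=> [hA uA] [hB uB]; split; first exact: mxhol_mul.
by rewrite unitmx_mul uA.
Qed.

Lemma unit_germ_inv n (A : C -> 'M[C]_n) :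
  unit_germ A -> unit_germ (fun t => invmx (A t)).
Proof.
move=> gA; have nu := near_unit_germ gA; case: gA => hA uA.
split; last by rewrite unitmx_inv.
apply: (@near_eq_mxhol _ _ (fun t => (\det (A t))^-1 *: \adj (A t))).
  by apply: filterS nu => t ut; rewrite /invmx ut.
apply: mxhol_scale; first by apply: (hol_inv (hol_det hA)); rewrite -unitfE -unitmxE.
move=> i j; apply: (@near_eq_hol _ (fun t =>
   (-1) ^+ (j + i) * \det (row' j (col' i (A t))))).
  by apply: near0W => t; rewrite mxE.
apply: hol_mul (hol_cst _) (hol_det _) => k l.
apply: near_eq_hol (hA (lift j k) (lift i l)).
by apply: near0W => t; rewrite !mxE.
Qed.

(** The local form of a Hecke modification, in arbitrary local frames. *)
Definition elem_germ (A : C -> 'M[C]_2) := exists P Q,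
  [/\ unit_germ P, unit_germ Q &
    \forall t \near (0 : C), A t = P t *m diag_mx (hvec 1 t)^T *m Q t].

Lemma near_eq_elem_germ (A B : C -> 'M[C]_2) :
  (\forall t \near (0 : C), A t = B t) -> elem_germ A -> elem_germ B.
Proof.
move=> AB [P [Q [hP hQ h]]]; exists P, Q; split=> //.
by apply: filterS2 AB h => t <-.
Qed.

Lemma elem_germ_mull (A B : C -> 'M[C]_2) :
  unit_germ A -> elem_germ B -> elem_germ (fun t => A t *m B t).
Proof.
move=> gA [P [Q [hP hQ h]]]; exists (fun t => A t *m P t), Q; split=> //.
  exact: unit_germ_mul.
by apply: filterS h => t ->; rewrite !mulmxA.
Qed.

Lemma elem_germ_mulr (A B : C -> 'M[C]_2) :
  elem_germ A -> unit_germ B -> elem_germ (fun t => A t *m B t).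
Proof.
move=> [P [Q [hP hQ h]]] gB; exists P, (fun t => Q t *m B t); split=> //.
  exact: unit_germ_mul.
by apply: filterS h => t ->; rewrite !mulmxA.
Qed.

Lemma unit_germ_prod (I : eqType) (r : seq I) (A : I -> C -> 'M[C]_2) :
  {in r, forall i, unit_germ (A i)} -> unit_germ (fun t => \prod_(i <- r) A i t).
Proof.
elim: r => [|i r IH] h.
  by apply: near_eq_unit_germ (unit_germ1 2); apply: near0W => t; rewrite big_nil.
have /IH hr : {in r, forall i, unit_germ (A i)}.
  by move=> j jr; apply: h; rewrite inE jr orbT.
apply: near_eq_unit_germ (unit_germ_mul (h i _) hr); last exact: mem_head.
by apply: near0W => t; rewrite big_cons.
Qed.

(** Distinct points: only one of the modifications is not invertible at p_k, and
    invertible factors on either side are absorbed in P and Q. *)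
Lemma elem_germ_prod (I : eqType) (r : seq I) (A : I -> C -> 'M[C]_2) k :
  uniq r -> k \in r -> elem_germ (A k) ->
  {in r, forall i, i != k -> unit_germ (A i)} ->
  elem_germ (fun t => \prod_(i <- r) A i t).
Proof.
move=> + + eA; elim: r => [//|i r IH] /= /andP[ir ur]; rewrite inE.
move=> /predU1P[ki|kr] h.
  apply: (@near_eq_elem_germ (fun t => A i t *m \prod_(i <- r) A i t)).
    by apply: near0W => t; rewrite big_cons.
  rewrite -ki; apply: elem_germ_mulr => //; apply: unit_germ_prod => j jr.
  by apply: h; [rewrite inE jr orbT|apply: contraNneq ir => jk; rewrite -ki -jk].
apply: (@near_eq_elem_germ (fun t => A i t *m \prod_(i <- r) A i t)).
  by apply: near0W => t; rewrite big_cons.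
apply: elem_germ_mull.
  by apply: h; [exact: mem_head|apply: contraNneq ir => ->].
by apply: IH => // j jr; apply: h; rewrite inE jr orbT.
Qed.

Lemma hvec_eta (T : nmodType) (v : 'cV[T]_2) : v = hvec (v 0 0) (v 1 0).
Proof.
apply/matrixP => i j; rewrite ord1 mxE.
by case: i => [[|[|//]] hi] /=; congr (v _ _); apply: val_inj.
Qed.

Lemma diag_hvec (a b : C) (v : 'cV[C]_2) :
  diag_mx (hvec a b)^T *m v = hvec (a * v 0 0) (b * v 1 0).
Proof.
rewrite [LHS]hvec_eta mul_diag_mx !mxE /=; congr hvec.
Qed.

Lemma det_elem_germ (A : C -> 'M[C]_2) : elem_germ A ->
  exists d, [/\ hol d, d 0 != 0 & \forall t \near (0 : C), \det (A t) = t * d t].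
Proof.
move=> [P [Q [[hP uP] [hQ uQ] h]]]; exists (fun t => \det (P t) * \det (Q t)).
split; first by apply: hol_mul; apply: hol_det.
  by rewrite mulf_neq0 -?unitfE -?unitmxE.
apply: filterS h => t ->; rewrite !det_mulmx det_diag big_ord_recl big_ord1 !mxE /=; ring.
Qed.

Definition map_germ A := unit_germ A \/ elem_germ A.

Lemma mxhol_map_germ A : map_germ A -> mxhol A.
Proof.
case=> [[]//|[P [Q [[hP _] [hQ _] h]]]].
apply: (@near_eq_mxhol _ _ (fun t => P t *m diag_mx (hvec 1 t)^T *m Q t)).
  by apply: filterS h.
apply: mxhol_mul hQ; apply: mxhol_mul hP _ => i j.
case: (eqVneq i j) => [<-|ij].
  case: i => [[|[|//]] hi].
    by apply: near_eq_hol (hol_cst 1); apply: near0W => t; rewrite !mxE eqxx.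
  by apply: near_eq_hol (hol_id C); apply: near0W => t; rewrite !mxE eqxx.
by apply: near_eq_hol (hol_cst 0); apply: near0W => t; rewrite !mxE (negbTE ij) mulr0n.
Qed.

Lemma near_map_germ_unit A : map_germ A -> \forall t \near (0 : C)^', A t \in unitmx.
Proof.
case=> [/near_unit_germ h|/det_elem_germ [d [hd d0 dA]]]; first exact: cvg_within.
have : \forall t \near (0 : C)^', t != 0 by exact: nbhs_dnbhs_neq.
have : \forall t \near (0 : C)^', \det (A t) = t * d t by exact: cvg_within.
have : \forall t \near (0 : C)^', `|d 0| / 2 <= `|d t|.
  by apply: cvg_within; exact: hol_near_neq0.
apply: filterS3 => t dt e t0; rewrite unitmxE unitfE e mulf_neq0//.
by rewrite -normr_gt0 (lt_le_trans _ dt)// divr_gt0 ?normr_gt0.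
Qed.

(** The only obstruction to solving A c = F with c holomorphic is the value at 0.
    For A = P diag(1, t) Q it says that the second coordinate of P^-1 F vanishes
    at 0, and then t divides this coordinate. *)
Lemma map_germ_solve A (F : C -> 'cV[C]_2) (x : 'cV[C]_2) :
  map_germ A -> mxhol F -> F 0 = A 0 *m x ->
  exists2 c, mxhol c & \forall t \near (0 : C), A t *m c t = F t.
Proof.
case=> [gA|[P [Q [gP gQ h]]]] hF Fx.
  exists (fun t => invmx (A t) *m F t).
    by apply: mxhol_mul => //; have [] := unit_germ_inv gA.
  by apply: filterS (near_unit_germ gA) => t ut; rewrite mulKVmx.
have [hP' _] := unit_germ_inv gP; have [hQ' _] := unit_germ_inv gQ.
pose G t := invmx (P t) *m F t.
have hG : mxhol G by apply: mxhol_mul.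
have G0 : G 0 1 0 = 0.
  rewrite /G Fx (nbhs_singleton h) -!mulmxA mulKmx; last by case: gP.
  by rewrite diag_hvec mxE /= mul0r.
have [g hg Gg] := hol_divX (hG 1 0) G0.
exists (fun t => invmx (Q t) *m hvec (G t 0 0) (g t)).
  apply: mxhol_mul => // i j; rewrite ord1.
  case: i => [[|[|//]] hi].
    by apply: near_eq_hol (hG 0 0); apply: near0W => t; rewrite !mxE.
  by apply: near_eq_hol hg; apply: near0W => t; rewrite !mxE.
have uQ := near_unit_germ gQ; have uP := near_unit_germ gP.
apply: filterS3 (filterI h Gg) uP uQ => t [-> Gt] uPt uQt.
rewrite -!mulmxA mulKVmx// diag_hvec.
set H := hvec _ _; have -> : H = G t; last by rewrite /G mulKVmx.
by rewrite [RHS]hvec_eta Gt /H; congr hvec; rewrite mxE /= ?mul1r.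
Qed.

(** At 0 the germ is P(0) diag(1, 0) Q(0). *)
Lemma elem_germ_rank1 A : elem_germ A ->
  exists (w : 'cV[C]_2) (y : 'rV[C]_2), [/\ w != 0, y != 0 & A 0 = w *m y].
Proof.
move=> [P [Q [[_ uP] [_ uQ] /nbhs_singleton ->]]].
exists (P 0 *m hvec 1 0), ((hvec 1 0)^T *m Q 0).
have e0 : hvec 1 0 != 0 :> 'cV[C]_2.
  apply/eqP => /matrixP /(_ 0 0); rewrite !mxE /= => /eqP.
  by rewrite oner_eq0.
split.
- by apply: contra e0 => /eqP e; rewrite -(mulKmx uP (hvec 1 0)) e mulmx0.
- apply: contra e0 => /eqP e; apply/eqP/trmx_inj.
  by rewrite -(mulmxK uQ (hvec 1 0)^T) e mul0mx trmx0.
suff -> : diag_mx (hvec 1 0)^T = hvec 1 0 *m (hvec 1 0)^T :> 'M[C]_2.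
  by rewrite !mulmxA.
apply/matrixP => i j; rewrite !mxE big_ord1 !mxE.
by case: i => [[|[|//]] hi]; case: j => [[|[|//]] hj]; rewrite /= ?mul1r ?mul0r ?mulr0n.
Qed.

End MatrixGerms.

(** * Bundles and bundle maps read in local frames *)

Section Bundles.
Variable R : realType.
Local Notation C := (Cx R).
Local Notation P1 := (CP1 R).

Lemma Cx_archimedean (K : C) : 0 <= K -> exists N : nat, K <= N%:R.
Proof.
case: K => a b; rewrite lecE /= => /andP[/eqP b0 a0].
exists (Num.bound a).
have -> : ((Num.bound a)%:R : C) = ((Num.bound a)%:R : R)%:C%C.
  by rewrite rmorph_nat.
by rewrite lecE /= b0 eqxx /= ltW// archi_boundP.
Qed.

Lemma holomorphic_atE (f : P1 -> C) x :
  holomorphic_at f x <-> hol (fun t => f (chart x t)).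
Proof.
split=> [[a ha]|]; first exact: hol_of_power_series ha.
by apply: power_series_of_hol; apply: cvg_geometric_half; exact: Cx_archimedean.
Qed.

(** The inverse of [chart x], with which a germ in the local coordinate becomes a
    function on the projective line. *)
Definition coord (x y : P1) : C :=
  match x, y with
  | Some a, Some z => z - a
  | None, Some z => z^-1
  | _, None => 0
  end.

Lemma chartK x : cancel (chart x) (coord x).
Proof.
case: x => [a|] t /=; first by rewrite addrC addKr.
by case: eqP => [->//|_] /=; rewrite invrK.
Qed.

Lemma chart0 x : chart x 0 = x :> P1.
Proof. by case: x => [a|] /=; rewrite ?addr0 ?eqxx. Qed.

Section Frames.
Variable k : nat.
Implicit Types E F : bundle R k.

Definition triv_at E x : idx E := sval (cid (dom_cover E x)).

Lemma dom_triv_at E x : dom (triv_at E x) x.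
Proof. exact: svalP (cid (dom_cover E x)). Qed.

(** A section or a map is studied near x through the single local frame chosen by
    [triv_at], as a germ in the local coordinate. *)
Definition frame_at E x t := frame (triv_at E x) (chart x t).

Lemma near_frame_unit E x (i : idx E) : dom i x ->
  \forall t \near (0 : C), frame i (chart x t) \in unitmx.
Proof.
move=> /(@dom_open _ _ E i x); apply: filterS => t; exact: frame_unit.
Qed.

Lemma near_frame_at_unit E x : \forall t \near (0 : C), frame_at E x t \in unitmx.
Proof. exact: near_frame_unit (dom_triv_at E x). Qed.

Lemma frame_change E x (i j : idx E) : dom i x -> dom j x ->
  mxhol (fun t : C => invmx (frame i (chart x t)) *m frame j (chart x t)).
Proof.
move=> ix jx a b; apply/(holomorphic_atE (fun y => (invmx (frame i y) *m frame j y) a b) x).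
exact: frame_holomorphic.
Qed.

(** Holomorphy in one local frame implies holomorphy in all of them, so that one
    frame per point is enough. *)
Lemma section_germP E x n (sg : P1 -> 'M[C]_(k, n)) :
  (forall i : idx E, dom i x ->
    mx_holomorphic_at (fun y => invmx (frame i y) *m sg y) x) <->
  mxhol (fun t => invmx (frame_at E x t) *m sg (chart x t)).
Proof.
split=> [h a b|h i ix a b].
  exact/(holomorphic_atE (fun y => (invmx (frame _ y) *m sg y) a b) x)/h/dom_triv_at.
apply/holomorphic_atE; move: a b.
apply: near_eq_mxhol (mxhol_mul (frame_change ix (dom_triv_at E x)) h).
apply: filterS (near_frame_at_unit E x) => t u.
by rewrite -mulmxA mulKVmx.
Qed.

End Frames.

Definition local_map k l (F : bundle R k) (E : bundle R l) (al : P1 -> 'M[C]_(l, k)) x t :=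
  invmx (frame_at E x t) *m al (chart x t) *m frame_at F x t.

Lemma bundle_map_germP k l (F : bundle R k) (E : bundle R l) (al : P1 -> 'M[C]_(l, k)) :
  bundle_map F E al <-> forall x, mxhol (local_map F E al x).
Proof.
split=> [h x a b|h i j x ix jx a b].
  exact/(holomorphic_atE (fun y => (invmx (frame (triv_at E x) y) *m al y *m
    frame (triv_at F x) y) a b) x)/h/dom_triv_at/dom_triv_at.
apply/holomorphic_atE; move: a b.
have := mxhol_mul (mxhol_mul (frame_change ix (dom_triv_at E x)) (h x))
  (frame_change (dom_triv_at F x) jx).
apply: near_eq_mxhol; apply: filterS2 (near_frame_at_unit E x) (near_frame_at_unit F x) => t uE uF.
by rewrite /local_map -!mulmxA !mulKVmx.
Qed.

Lemma local_frame_germ k (E : bundle R k) x g : local_frame E x g ->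
  unit_germ (fun t => invmx (frame_at E x t) *m g (chart x t)).
Proof.
move=> [ug /section_germP hg]; split=> //.
by rewrite unitmx_mul unitmx_inv (nbhs_singleton (near_frame_at_unit E x)) (nbhs_singleton ug).
Qed.

Lemma hecke_unit_germ (F E : bundle R 2) p al x :
  hecke_modification F E p al -> x <> p -> unit_germ (local_map F E al x).
Proof.
move=> [/bundle_map_germP h ual _] xp; split=> //.
rewrite /local_map !unitmx_mul unitmx_inv (nbhs_singleton (near_frame_at_unit E x)).
by rewrite (nbhs_singleton (near_frame_at_unit F x)) chart0 ual.
Qed.

Lemma hecke_elem_germ (F E : bundle R 2) p al :
  hecke_modification F E p al -> elem_germ (local_map F E al p).
Proof.
move=> [_ _ [f [g [lf lg h]]]].
exists (fun t => invmx (frame_at E p t) *m g (chart p t)),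
  (fun t => invmx (invmx (frame_at F p t) *m f (chart p t))); split.
- exact: local_frame_germ.
- exact/unit_germ_inv/local_frame_germ.
have uf := near_unit_germ (local_frame_germ lf).
apply: filterS3 h uf (near_frame_at_unit F p) => t e u uF.
rewrite /local_map -[_ *m g _ *m _]mulmxA -e.
apply: (canRL (mulmxK u)); rewrite -!mulmxA mulKVmx//.
Qed.

End Bundles.

(** * The composite map of a sequence of Hecke modifications *)

Section HeckeSequences.
Variables (R : realType) (n : nat) (mu : 'I_n -> Cx R).
Hypothesis mu_inj : injective mu.
Local Notation C := (Cx R).
Local Notation P1 := (CP1 R).
Local Notation p := (fun i : 'I_n => Some (mu i) : P1).
Implicit Types s : hecke_seq p.

Lemma prod_telescope m (F : 'I_m.+1 -> 'M[C]_2) (a : 'I_m -> 'M[C]_2) :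
    (forall i, F i \in unitmx) ->
  \prod_(j < m) (invmx (F (widen_ord (leqnSn m) j)) *m a j *m F (lift ord0 j)) =
  invmx (F ord0) *m (\prod_(j < m) a j) *m F ord_max.
Proof.
elim: m F a => [|m IH] F a uF.
  rewrite !big_ord0 mulmx1 (_ : ord_max = ord0) ?mulVmx//.
  exact: val_inj.
rewrite !big_ord_recr /=.
have := IH (fun i => F (widen_ord (leqnSn _) i)) (fun i => a (widen_ord (leqnSn _) i))
  (fun i => uF _).
have -> : widen_ord (leqnSn m.+1) (ord0 : 'I_m.+1) = ord0 by apply: val_inj.
have -> : lift ord0 ord_max = ord_max :> 'I_m.+2 by apply: val_inj.
rewrite (eq_bigr (fun j : 'I_m =>
  invmx (F (widen_ord (leqnSn m.+1) (widen_ord (leqnSn m) j))) *m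
  a (widen_ord (leqnSn m) j) *m F (lift ord0 (widen_ord (leqnSn m) j)))); last first.
  by move=> j _; congr (_ *m F _); apply: val_inj.
by move=> ->; rewrite -!mulmxE -!mulmxA mulKVmx.
Qed.

Definition last_bundle s := hs_bundle s ord_max.

(** The frame of E_0 is the identity, so this is the composite map E_n -> E_0
    read in local frames. *)
Definition total_germ s x t := hs_total s (chart x t) *m frame_at (last_bundle s) x t.

Lemma frame_trivial (E : bundle R 2) (i : idx E) x :
  E = trivial_bundle R 2 -> frame i x = 1%:M.
Proof. by move=> e; move: i; rewrite e. Qed.

Lemma near_total_germ s x : \forall t \near (0 : C),
  \prod_(j <- index_enum 'I_n) local_map (hs_bundle s (lift ord0 j))
     (hs_bundle s (widen_ord (leqnSn n) j)) (hs_map s j) x t = total_germ s x t.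
Proof.
have : \forall t \near (0 : C), forall i, frame_at (hs_bundle s i) x t \in unitmx.
  apply: (@filter_forall _ _ (fun i t => frame_at (hs_bundle s i) x t \in unitmx)
    _ (nbhs_filter (0 : C))) => i.
  exact: near_frame_at_unit.
apply: filterS => t ut.
rewrite /local_map (prod_telescope (F := fun i => frame_at (hs_bundle s i) x t))//.
by rewrite {1}/frame_at (frame_trivial _ _ (hs_bundle0 s)) invmx1 mul1mx.
Qed.

Lemma total_unit_germ s x : (forall i, x <> p i) -> unit_germ (total_germ s x).
Proof.
move=> xp; apply: near_eq_unit_germ (near_total_germ s x) _.
by apply: unit_germ_prod => i _; apply: hecke_unit_germ (hs_hecke s i) (xp i).
Qed.

Lemma total_elem_germ s i : elem_germ (total_germ s (p i)).
Proof.
apply: near_eq_elem_germ (near_total_germ s _) _.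
apply: (@elem_germ_prod _ _ _ _ i); rewrite ?index_enum_uniq ?mem_index_enum//.
  exact: hecke_elem_germ (hs_hecke s i).
move=> j _ ji; apply: hecke_unit_germ (hs_hecke s j) _ => -[/mu_inj /esym/eqP].
by rewrite (negbTE ji).
Qed.

Lemma total_map_germ s x : map_germ (total_germ s x).
Proof.
have [[i ->]|h] := pselect (exists i, x = p i).
  by right; exact: total_elem_germ.
by left; apply: total_unit_germ => i xi; apply: h; exists i.
Qed.

Lemma total_germ0 s x :
  total_germ s x 0 = hs_total s x *m frame_at (last_bundle s) x 0.
Proof. by rewrite /total_germ chart0. Qed.

Lemma frame_at_unit0 k (E : bundle R k) x : frame_at E x 0 \in unitmx.
Proof. exact: nbhs_singleton (near_frame_at_unit E x). Qed.

(** The factors of index > i are invertible at p_i, which makes [hs_comp s i] and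
    [hs_total s] have the same image there. *)
Lemma hs_total_split s i x : exists2 B, hs_total s x = hs_comp s i x *m B &
  (forall j : 'I_n, (i < j)%N -> hs_map s j x \in unitmx) -> B \in unitmx.
Proof.
pose F k := if insub k is Some j then hs_map s j x else 1.
have FE (j : 'I_n) : F j = hs_map s j x by rewrite /F valK.
exists (\prod_(i.+1 <= j < n) F j).
  have -> : hs_total s x = \prod_(0 <= j < n) F j.
    by rewrite big_mkord; apply: eq_bigr => j _; rewrite FE.
  have -> : hs_comp s i x = \prod_(0 <= j < n | (j <= i)%N) F j.
    by rewrite big_mkord; apply: eq_bigr => j _; rewrite FE.
  rewrite (@big_cat_nat _ _ _ i.+1) //= ; congr (_ * _).
  by rewrite [LHS](big_nat_widen 0 i.+1 n).
move=> h; rewrite big_nat; elim/big_ind: _ => [|A B uA uB|k /andP[ik kn]].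
- exact: unitmx1.
- by rewrite -mulmxE unitmx_mul uA.
- by rewrite /F insubT; apply: h.
Qed.

Lemma hs_comp_split s i : exists2 B, B \in unitmx &
  hs_total s (p i) = hs_comp s i (p i) *m B.
Proof.
have [B e uB] := hs_total_split s i (p i); exists B => //.
apply: uB => j ij; have [_ + _] := hs_hecke s j; apply.
by move=> [/mu_inj ji]; rewrite ji ltnn in ij.
Qed.

Lemma memv_lin_of_mx (M : 'M[C]_2) v :
  reflect (exists x, v = M *m x) (v \in limg (lin_of_mx M)).
Proof.
apply: (iffP memv_imgP) => [[x _ ->]|[x ->]]; exists x; rewrite ?memvf ?lfunE//.
Qed.

Lemma hs_comp_line s i : \dim (limg (lin_of_mx (hs_comp s i (p i)))) == 1%N.
Proof.
have [B uB e] := hs_comp_split s i.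
have [w [y [w0 y0]]] := elem_germ_rank1 (total_elem_germ s i).
rewrite total_germ0 e -mulmxA => e'.
have uB' : B *m frame_at (last_bundle s) (p i) 0 \in unitmx.
  by rewrite unitmx_mul uB frame_at_unit0.
set L := limg _; have -> : L = <[w]>%VS; last by rewrite dim_vline w0.
have eM := canRL (mulmxK uB') e'.
apply/vspaceP => v; apply/memv_lin_of_mx/vlineP => [[x ->]|[k ->]].
  rewrite eM -!mulmxA.
  set c : 'M_1 := y *m _; exists (c 0 0).
  by rewrite {1}(mx11_scalar c) mul_mx_scalar.
have [z yz] : exists z, y 0 z != 0.
  apply/existsP; apply: contraNT y0; rewrite negb_exists => /forallP h.
  by apply/eqP/rowP => z; rewrite mxE; apply/eqP; rewrite -[_ == _]negbK h.
set D := B *m _ in eM uB'.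
exists (k *: (D *m ((y 0 z)^-1 *: delta_mx z 0))).
rewrite eM -!scalemxAr -(mulmxA (w *m y)) mulKmx//.
have -> : w *m y *m delta_mx z 0 = y 0 z *: w.
  rewrite -mulmxA -colE -[w *m _]/(w *m col z y) (mx11_scalar (col z y)) mul_mx_scalar.
  by rewrite mxE.
by rewrite !scalerA -mulrA mulVf// mulr1.
Qed.

(** The line l_(p_i) of the Hecke embedding. *)
Definition hline s i : line R :=
  exist (fun l : {vspace _} => \dim l == 1%N) _ (hs_comp_line s i).

Lemma hlineP s i v :
  reflect (exists x, v = hs_total s (p i) *m x) (v \in val (hline s i)).
Proof.
have [B uB e] := cid2 (hs_comp_split s i); rewrite e.
apply: (iffP (memv_lin_of_mx _ _)) => [[x ->]|[x ->]].
  by exists (invmx B *m x); rewrite -mulmxA mulKVmx.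
by exists (B *m x); rewrite mulmxA.
Qed.

Definition eval_vec (f : 'cV[{poly C}]_2) (z : C) : 'cV[C]_2 := map_mx (horner_eval z) f.

Definition in_lines s f := forall i, eval_vec f (mu i) \in val (hline s i).

Lemma image_L_in_lines s f : image_L s f -> in_lines s f.
Proof. by move=> [sg _ h] i; apply/hlineP; exists (sg (p i)); rewrite /eval_vec h. Qed.

Lemma mxhol_eval_vec f z : mxhol (fun t => eval_vec f (z + t)).
Proof.
move=> i j; apply: (@near_eq_hol _ (fun t => (f i j).[z + t])).
  by apply: near0W => t; rewrite !mxE.
exact: hol_poly (hol_add (hol_cst _) (hol_id _)).
Qed.

(** Near each point the equation alpha c = f has a holomorphic solution, by
    [map_germ_solve].  Away from the centre alpha is invertible, so the local
    solutions agree and glue to a section. *)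
Lemma finite_lift s f : in_lines s f -> exists sg : P1 -> 'cV[C]_2,
  (forall z, hs_total s (Some z) *m sg (Some z) = eval_vec f z) /\
  (forall z, mxhol (fun t => invmx (frame_at (last_bundle s) (Some z) t) *m
     sg (chart (Some z) t))).
Proof.
move=> fW.
have loc z : exists2 c, mxhol c &
    \forall t \near (0 : C), total_germ s (Some z) t *m c t = eval_vec f (z + t).
  have [x fx] : exists x, eval_vec f (z + 0) = total_germ s (Some z) 0 *m x.
    rewrite total_germ0 addr0.
    have [[i ->]|h] := pselect (exists i, z = mu i).
      have /hlineP [x ->] := fW i.
      exists (invmx (frame_at (last_bundle s) (p i) 0) *m x).
      by rewrite -mulmxA mulKVmx// frame_at_unit0.
    have [] : unit_germ (total_germ s (Some z)).
      by apply: total_unit_germ => i [zi]; apply: h; exists i.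
    rewrite total_germ0 => _ u.
    by exists (invmx (hs_total s (Some z) *m frame_at (last_bundle s) (Some z) 0) *m eval_vec f z);
      rewrite mulKVmx.
  exact: map_germ_solve (total_map_germ s _) (mxhol_eval_vec f z) fx.
pose c z := sval (cid2 (loc z)).
have hc z : mxhol (c z) by rewrite /c; case: cid2.
have ec z : \forall t \near (0 : C),
    total_germ s (Some z) t *m c z t = eval_vec f (z + t) by rewrite /c; case: cid2.
pose sg (y : P1) := if y is Some z then frame_at (last_bundle s) y 0 *m c z 0 else 0.
have sgE z : hs_total s (Some z) *m sg (Some z) = eval_vec f z.
  by rewrite /sg mulmxA -total_germ0 (nbhs_singleton (ec z)) addr0.
exists sg; split=> // z; apply: near_eq_mxhol (hc z).
have nu := near_map_germ_unit (total_map_germ s (Some z)).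
have : \forall t \near (0 : C), t != 0 -> total_germ s (Some z) t \in unitmx by exact: nu.
apply: filterS3 (ec z) (near_frame_at_unit (last_bundle s) (Some z)) => t e uf.
have [->|t0] := eqVneq t 0 => u.
  by rewrite chart0 /sg mulKmx// frame_at_unit0.
have ut : hs_total s (chart (Some z) t) \in unitmx.
  by have := u isT; rewrite /total_germ unitmx_mul => /andP[].
apply: (canRL (mulKmx uf)); apply: (can_inj (mulKmx ut)).
by rewrite mulmxA -/(total_germ _ _ _) e /= sgE.
Qed.

End HeckeSequences.

(** * Polynomial vectors at infinity and the bundles O(-d) *)

Section Reversal.
Variable C : numFieldType.

(** In the coordinate t = 1 / z, a polynomial q of degree at most N is
    t^(-N) times this polynomial. *)
Definition rev_poly N (q : {poly C}) : {poly C} := \poly_(i < N.+1) q`_(N - i).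

Lemma horner_rev_poly N (q : {poly C}) t : (size q <= N.+1)%N -> t != 0 ->
  (rev_poly N q).[t] = t ^+ N * q.[t^-1].
Proof.
move=> sq t0; rewrite horner_poly (horner_coef_wide _ sq) mulr_sumr.
rewrite (reindex_inj rev_ord_inj) /=; apply: eq_bigr => i _.
have iN : (i <= N)%N by rewrite -ltnS.
rewrite subSS subKn// mulrCA; congr (_ * _).
have -> : t ^+ N = t ^+ (N - i) * t ^+ i by rewrite -exprD subnK.
by rewrite exprVn mulfK ?expf_neq0.
Qed.

Lemma horner_rev_poly0 N (q : {poly C}) : (rev_poly N q).[0] = q`_N.
Proof. by rewrite horner_coef0 coef_poly /= subn0. Qed.

End Reversal.

Section NegativeLineBundle.
Variables (R : realType) (d : nat).
Local Notation C := (Cx R).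
Local Notation P1 := (CP1 R).

Definition oneg_dom (b : bool) : set P1 :=
  if b then [set x | x <> Some 0] else [set x | x <> None].

(** The bundle O(-d): the fibers over the affine part carry the frame 1, and the
    frame at infinity is z^(-d) = t^d times it. *)
Definition oneg_frame (b : bool) (x : P1) : 'M[C]_1 :=
  if b then (if x is Some z then z^-1 ^+ d else 1)%:M else 1%:M.

Lemma oneg_dom_open b : open_CP1 (oneg_dom b).
Proof.
case: b => -[a|] //= xa.
- have a0 : a != 0 by apply: contra_notN xa => /eqP->.
  have a0' : 0 < `|a| by rewrite normr_gt0.
  apply: filterS (near0_lt a0') => t ta [/eqP].
  by rewrite addr_eq0 => /eqP e; rewrite e normrN ltxx in ta.
- apply: near0W => t; case: eqP => // /eqP t0 [/eqP].
  by rewrite invr_eq0 (negbTE t0).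
- by apply: near0W.
Qed.

Lemma oneg_dom_cover x : exists b, oneg_dom b x.
Proof. by case: x => [a|]; [exists false|exists true]. Qed.

Lemma oneg_frame_unit b x : oneg_dom b x -> oneg_frame b x \in unitmx.
Proof.
case: b => /=; last by rewrite unitmx1.
case: x => [z|]; rewrite unitmxE det_scalar1 ?unitr1// => z0.
by rewrite unitfE expf_neq0// invr_eq0; apply: contra_notN z0 => /eqP->.
Qed.

Lemma mxhol_oneg_frame b z : oneg_dom b (Some z) ->
  unit_germ (fun t => oneg_frame b (chart (Some z) t)).
Proof.
move=> bz; split; last by rewrite oneg_frame_unit// chart0.
move=> i j; rewrite !ord1; case: b bz => /= z0.
  have h : hol (fun t : C => (z + t)^-1 ^+ d).
    apply: hol_exp; apply: hol_inv; first exact: hol_add (hol_cst _) (hol_id _).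
    by rewrite addr0; apply: contra_notN z0 => /eqP->.
  by apply: near_eq_hol h; apply: near0W => t; rewrite mxE eqxx mulr1n.
exact: hol_cst.
Qed.

Lemma oneg_frame_holomorphic b b' x : oneg_dom b x -> oneg_dom b' x ->
  mx_holomorphic_at (fun y => invmx (oneg_frame b y) *m oneg_frame b' y) x.
Proof.
move=> bx bx' i j; apply/holomorphic_atE; move: i j.
case: x bx bx' => [z|] bx bx'.
  have [h _] := unit_germ_inv (mxhol_oneg_frame bx).
  by apply: mxhol_mul h _; have [] := mxhol_oneg_frame bx'.
case: b bx => //= _; case: b' bx' => //= _.
apply: near_eq_mxhol (mxhol_cst 1%:M); apply: near0W => t.
rewrite mulVmx// (oneg_frame_unit (b := true))//=.
by case: eqP => // /eqP t0 [/eqP]; rewrite invr_eq0 (negbTE t0).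
Qed.

Definition oneg_bundle : bundle R 1 :=
  @Bundle R 1 bool oneg_dom oneg_frame oneg_dom_open oneg_dom_cover
    oneg_frame_unit oneg_frame_holomorphic.

Lemma oneg_frame_infty (t : C) :
  oneg_frame true (chart None t) = (if t == 0 then 1 else t ^+ d)%:M.
Proof. by rewrite /=; case: eqP => //= _; rewrite invrK. Qed.

(** The constant section 1 has no zero or pole but a pole of order d at infinity. *)
Lemma degree_oneg : has_degree oneg_bundle (- d%:Z).
Proof.
exists (fun=> 1), (fun x => if x is None then - d%:Z else 0); split.
- case=> [z|].
    exists false; split=> //; exists (fun=> 1); split; rewrite ?oner_neq0//.
      by apply/holomorphic_atE; exact: hol_cst.
    by near=> t; rewrite /= det1 expr0z invr1.
  exists true; split=> //; exists (fun=> 1); split; rewrite ?oner_neq0//.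
    by apply/holomorphic_atE; exact: hol_cst.
  have : \forall t \near (0 : C)^', t != 0 by exact: nbhs_dnbhs_neq.
  apply: filterS => t t0; rewrite [frame _ _]oneg_frame_infty (negbTE t0).
  by rewrite det_scalar1 !mulr1 -invr_expz.
- by apply: (@sub_finite_set _ _ [set None]) => // -[z|] //=; rewrite ?eqxx.
- rewrite (@fsbigE _ _ _ _ _ [:: None]) //=; last by case=> // _; rewrite inE.
  by rewrite big_mkcond big_seq1 in_setT.
Unshelve. all: by end_near.
Qed.

End NegativeLineBundle.

(** * The image of the sections, and what semistability says about it *)

Section Semistability.
Variables (R : realType) (n : nat) (mu : 'I_n -> Cx R).
Hypothesis mu_inj : injective mu.
Local Notation C := (Cx R).
Local Notation P1 := (CP1 R).
Local Notation p := (fun i : 'I_n => Some (mu i) : P1).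
Local Notation in_lines := (in_lines mu_inj).
Implicit Types (s : hecke_seq p) (f : 'cV[{poly C}]_2) (sg : P1 -> 'cV[C]_2).

(** The inverse of det alpha is a section of det E_n with a simple pole at each
    p_i, by [det_elem_germ], and no other zero or pole. *)
Lemma degree_last_bundle s : has_degree (last_bundle s) (- n%:Z).
Proof.
exists (fun x => (\det (hs_total s x))^-1),
  (fun x => if [exists i, p i == x] then -1 else 0); split.
- move=> x; exists (triv_at (last_bundle s) x); split; first exact: dom_triv_at.
  have [[i ->]|h] := pselect (exists i, x = p i).
    have -> : [exists i0, p i0 == p i] by apply/existsP; exists i.
    have [d [hd d0 hdet]] := det_elem_germ (total_elem_germ mu_inj s i).
    exists (fun y => (d (coord (p i) y))^-1); split.
    + apply/holomorphic_atE; apply: near_eq_hol (hol_inv hd d0).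
      by apply: near0W => t; rewrite chartK.
    + by rewrite -[X in coord _ X]chart0 chartK invr_eq0.
    have : \forall t \near (0 : C)^', \det (total_germ s (p i) t) = t * d t.
      exact: cvg_within.
    apply: filterS => t; rewrite det_mulmx chartK => e.
    by rewrite -invfM mulrC e invfM.
  have -> : [exists i0, p i0 == x] = false.
    by apply/negbTE/existsP => -[i /eqP xi]; apply: h; exists i.
  have g : unit_germ (total_germ s x).
    by apply: total_unit_germ => i xi; apply: h; exists i.
  have hd := hol_det g.1.
  have d0 : \det (total_germ s x 0) != 0 by have [_] := g; rewrite unitmxE unitfE.
  exists (fun y => (\det (total_germ s x (coord x y)))^-1); split.
  + apply/holomorphic_atE; apply: near_eq_hol (hol_inv hd d0).
    by apply: near0W => t; rewrite chartK.
  + by rewrite -[X in coord _ X]chart0 chartK invr_eq0.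
  near=> t; rewrite chartK expr0z mul1r /total_germ det_mulmx invfM.
  by rewrite mulrC.
- apply: (@sub_finite_set _ _ [set` codom p]); last exact: finite_seq.
  move=> x /=; case: ifPn => [/existsP [i /eqP <-] _|]; last by rewrite eqxx.
  exact: codom_f.
- have pinj : injective p by move=> i j [/mu_inj].
  have up : uniq (codom p) by rewrite (map_inj_uniq pinj) enum_uniq.
  rewrite (@fsbigE _ _ _ _ _ (codom p)) //.
    rewrite (eq_bigl xpredT) => [|x]; last by rewrite in_setT.
    rewrite big_map big_enum /= (eq_bigr (fun=> -1)); last first.
      by move=> i _; rewrite (_ : [exists j, p j == p i])//; apply/existsP; exists i.
    by rewrite sumr_const card_ord mulNrn natz.
  move=> x _ xp; rewrite ifN//; apply: contraNN xp => /existsP [i /eqP <-].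
  exact: codom_f.
Unshelve. all: by end_near.
Qed.

Definition rev_vec N f (t : C) : 'cV[C]_2 :=
  \col_i (rev_poly N (f i 0)).[t].

Lemma mxhol_rev_vec N f : mxhol (rev_vec N f).
Proof.
move=> i j; apply: near_eq_hol (hol_poly (rev_poly N (f i 0)) (hol_id _)).
by apply: near0W => t; rewrite mxE.
Qed.

Lemma eval_vec_rev N f t : (forall i, (size (f i 0%R) <= N.+1)%N) -> t != 0 ->
  t ^+ N *: eval_vec f t^-1 = rev_vec N f t.
Proof.
move=> sf t0; apply/matrixP => i j; rewrite !ord1 !mxE /horner_eval.
by rewrite horner_rev_poly.
Qed.

(** E_n is identified with E_0 by alpha near infinity, and there f has a pole of
    order at most N. *)
Lemma infty_lift s f sg N :
    (forall z, hs_total s (Some z) *m sg (Some z) = eval_vec f z) ->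
    (forall i, (size (f i 0%R) <= N.+1)%N) ->
  \forall t \near (0 : C), t != 0 ->
    t ^+ N *: (invmx (frame_at (last_bundle s) None t) *m sg (chart None t)) =
    invmx (total_germ s None t) *m rev_vec N f t.
Proof.
move=> sgE sf.
have g : unit_germ (total_germ s None) by apply: total_unit_germ.
apply: filterS2 (near_unit_germ g) (near_frame_at_unit (last_bundle s) None) => t u uf t0.
apply: (canRL (mulKmx u)); rewrite -scalemxAr /total_germ -!mulmxA mulKVmx//.
by rewrite /= (negbTE t0) sgE eval_vec_rev.
Qed.

(** The condition f(mu_i) \in l_i is the local solvability of alpha c = f at p_i;
    at infinity the solution is meromorphic because f is a polynomial. *)
Lemma image_LE s : image_L s = in_lines s :> set _.
Proof.
apply/seteqP; split=> f; first exact: image_L_in_lines.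
move=> fW; have [sg [sgE hsg]] := finite_lift fW.
exists sg => //; split=> [z i iz|i ix]; first by move: i iz; apply/section_germP.
pose N := maxn (size (f 0 0)) (size (f 1 0)).
have sf i0 : (size (f i0 0%R) <= N.+1)%N.
  by apply: leqW; rewrite /N; case: i0 => [[|[|//]] hi];
    [rewrite (_ : Ordinal hi = 0) ?leq_maxl//|rewrite (_ : Ordinal hi = 1) ?leq_maxr//];
    exact: val_inj.
exists N, (fun y => invmx (frame i y) *m frame (triv_at (last_bundle s) None) y *m
  (invmx (total_germ s None (coord None y)) *m rev_vec N f (coord None y))).
have g : unit_germ (total_germ s None) by apply: total_unit_germ.
split.
  move=> a b; apply/holomorphic_atE; move: a b.
  apply: mxhol_mul; first by apply: frame_change => //; exact: dom_triv_at.
  have [h _] := unit_germ_inv g.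
  apply: near_eq_mxhol (mxhol_mul h (mxhol_rev_vec N f)); apply: near0W => t.
  by rewrite chartK.
have h := infty_lift sgE sf.
have : \forall t \near (0 : C), t != 0 ->
  t ^+ N *: (invmx (frame i (chart None t)) *m sg (chart None t)) =
  invmx (frame i (chart None t)) *m frame (triv_at (last_bundle s) None) (chart None t) *m
  (invmx (total_germ s None (coord None (chart None t : P1))) *m
   rev_vec N f (coord None (chart None t : P1))).
  apply: filterS2 h (near_frame_at_unit (last_bundle s) None) => t e u t0.
  rewrite chartK -e// -scalemxAr -!mulmxA mulKVmx//.
by [].
Qed.

Lemma mxhol_divX m q (A : C -> 'M[C]_(m, q)) : mxhol A -> A 0 = 0 ->
  exists2 B, mxhol B & \forall t \near (0 : C), A t = t *: B t.
Proof.
move=> hA A0.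
have h i j : exists2 g, hol g & \forall t \near (0 : C), A t i j = t * g t.
  by apply: hol_divX => //; rewrite A0 mxE.
pose g i j := sval (cid2 (h i j)).
exists (fun t => \matrix_(i, j) g i j t).
  move=> i j; apply: (@near_eq_hol _ (g i j)).
    by apply: near0W => t; rewrite mxE.
  by rewrite /g; case: cid2.
have e : \forall t \near (0 : C), forall i j, A t i j = t * g i j t.
  apply: (@filter_forall _ _ (fun i t => forall j, A t i j = t * g i j t)
    _ (nbhs_filter (0 : C))) => i.
  apply: (@filter_forall _ _ (fun j t => A t i j = t * g i j t)
    _ (nbhs_filter (0 : C))) => j.
  by rewrite /g; case: cid2.
by apply: filterS e => t e; apply/matrixP => i j; rewrite !mxE.
Qed.

(** If the section sg of E_n over f vanishes at z0, then sg / (z - z0) is a section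
    over f'.  Only the condition at mu_i = z0 depends on this, since elsewhere f' is
    proportional to f; it follows by continuity at z0. *)
Lemma lift_vanish s f (f' : 'cV[{poly C}]_2) sg z0 :
    (forall z, hs_total s (Some z) *m sg (Some z) = eval_vec f z) ->
    (forall z, mxhol (fun t => invmx (frame_at (last_bundle s) (Some z) t) *m
       sg (chart (Some z) t))) ->
    in_lines s f -> sg (Some z0) = 0 ->
    (forall z, eval_vec f z = (z - z0) *: eval_vec f' z) ->
  in_lines s f'.
Proof.
move=> sgE hsg fW s0 ff' i.
have [iz|iz] := eqVneq (mu i) z0; last first.
  have := fW i; rewrite ff' => h.
  have a0 : mu i - z0 != 0 by rewrite subr_eq0.
  have := memvZ (mu i - z0)^-1 h; by rewrite scalerA mulVf// scale1r.
have c0 : invmx (frame_at (last_bundle s) (Some z0) 0) *m sg (chart (Some z0) 0) = 0.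
  by rewrite chart0 s0 mulmx0.
have [c hc ec] := mxhol_divX (hsg z0) c0.
have T0 : total_germ s (Some z0) 0 *m c 0 - eval_vec f' (z0 + 0) = 0.
  apply: (@mxhol_eq0 _ _ _ (fun t => total_germ s (Some z0) t *m c t - eval_vec f' (z0 + t))).
    have h1 := mxhol_mul (mxhol_map_germ (total_map_germ mu_inj s (Some z0))) hc.
    move=> a b; apply: near_eq_hol (hol_add (h1 a b)
      (hol_mul (hol_cst (-1)) (mxhol_eval_vec f' z0 a b))).
    by apply: near0W => t; rewrite !mxE mulN1r.
  have e : \forall t \near (0 : C), t != 0 ->
      total_germ s (Some z0) t *m c t - eval_vec f' (z0 + t) = 0.
    apply: filterS2 ec (near_frame_at_unit (last_bundle s) (Some z0)) => t e u t0.
    have := sgE (z0 + t); rewrite ff' addrAC subrr add0r.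
    have -> : sg (Some (z0 + t)) = frame_at (last_bundle s) (Some z0) t *m (t *: c t).
      by rewrite -e mulKVmx.
    rewrite -scalemxAr -scalemxAr => /(scalerI t0) <-.
    by rewrite /total_germ mulmxA subrr.
  exact: e.
apply/hlineP; exists (frame_at (last_bundle s) (Some z0) 0 *m c 0).
rewrite /= iz mulmxA -total_germ0; apply/eqP; rewrite eq_sym -subr_eq0.
by rewrite -{2}(addr0 z0) T0.
Qed.

(** A lift of f without zeros, where f has degree exactly d, is a nowhere
    vanishing map O(-d) -> E_n, that is, a line subbundle of degree -d of a bundle
    of degree -n. *)
Lemma nonvanishing_degree s f sg d : semistable (last_bundle s) ->
    (forall z, hs_total s (Some z) *m sg (Some z) = eval_vec f z) ->
    (forall z, mxhol (fun t => invmx (frame_at (last_bundle s) (Some z) t) *m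
       sg (chart (Some z) t))) ->
    (forall i, (size (f i 0%R) <= d.+1)%N) -> (forall z, sg (Some z) != 0) ->
    rev_vec d f 0 != 0 ->
  (n <= 2 * d)%N.
Proof.
move=> ss sgE hsg sf sg0 rev0.
have g : unit_germ (total_germ s None) by apply: total_unit_germ.
have [_] := g; rewrite total_germ0 unitmx_mul => /andP[u0 _].
pose J (y : P1) := if y is Some z then sg y else invmx (hs_total s None) *m rev_vec d f 0.
have J0 x : J x != 0.
  case: x => [z|]; first exact: sg0.
  apply: contra rev0 => /eqP e.
  by rewrite -(mulKVmx u0 (rev_vec d f 0)) -[X in _ *m X]/(J None) e mulmx0.
suff sub : line_subbundle (last_bundle s) (oneg_bundle R d) J.
  have := ss _ _ _ _ sub (degree_oneg R d) (degree_last_bundle s).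
  by rewrite mulNrn lerN2 -mulr_natl natz -PoszM lez_nat.
split=> // i b x ix bx.
move: i ix; suff : forall i : idx (last_bundle s), dom i x ->
    mx_holomorphic_at (fun y => invmx (frame i y) *m (J y *m oneg_frame d b y)) x.
  by move=> h i /h {}h a c; have := h a c; rewrite /=; under eq_fun do rewrite mulmxA.
apply/section_germP; case: x bx => [z|] bx.
  have h := mxhol_mul (hsg z) (mxhol_oneg_frame d bx).1.
  by apply: near_eq_mxhol h; apply: near0W => t; rewrite -mulmxA.
case: b bx => // _.
have [h _] := unit_germ_inv g.
apply: near_eq_mxhol (mxhol_mul h (mxhol_rev_vec d f)).
apply: filterS2 (infty_lift sgE sf) (near_frame_at_unit (last_bundle s) None) => t e u.
rewrite oneg_frame_infty mul_mx_scalar; have [->|t0] := eqVneq t 0.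
  rewrite scale1r chart0 /J total_germ0.
  have ug : hs_total s None *m frame_at (last_bundle s) None 0 \in unitmx.
    by rewrite unitmx_mul u0 frame_at_unit0.
  by apply: (canLR (mulKmx ug)); rewrite -mulmxA !mulKVmx// frame_at_unit0.
by rewrite -e// -scalemxAr /= (negbTE t0).
Qed.

(** Take f of minimal degree d.  Its lift has no zero on the affine part, or else f
    could be divided by z - z0, so [nonvanishing_degree] gives n <= 2 d.  The
    induction is on a bound m = d + 1 of the sizes of the entries. *)
Lemma semistable_degree s f m : semistable (last_bundle s) -> in_lines s f ->
  (forall i, (size (f i 0%R) <= m)%N) -> (2 * m < n + 2)%N -> f = 0.
Proof.
move=> ss; elim: m f => [|d IH] f fW sf dn.
  by apply/matrixP => i j; rewrite ord1 mxE; apply/eqP; rewrite -size_poly_leq0.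
have dn' : (2 * d < n + 2)%N by apply: leq_ltn_trans dn; rewrite leq_mul2l leqnSn.
(* the lift either vanishes somewhere on the affine part, or the bound on the
   degree is not sharp, or the lift spans a line subbundle *)
have [sg [sgE hsg]] := finite_lift fW.
have [[z0 s0]|sg0] := pselect (exists z, sg (Some z) = 0).
  have fz0 i : root (f i 0) z0.
    have := sgE z0; rewrite s0 mulmx0 => /matrixP /(_ i 0).
    by rewrite !mxE /horner_eval => /esym/eqP.
  pose f' : 'cV[{poly C}]_2 := \col_i (f i 0 %/ ('X - z0%:P)).
  have fE i : f i 0 = f' i 0 * ('X - z0%:P).
    by rewrite mxE divpK// dvdp_XsubCl.
  have ff' z : eval_vec f z = (z - z0) *: eval_vec f' z.
    apply/matrixP => i j; rewrite ord1 [LHS]mxE [RHS]mxE [eval_vec _ _ _ _]mxE.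
    by rewrite /horner_eval fE hornerM hornerXsubC mulrC.
  have f'0 : f' = 0.
    apply: IH dn' => [|i]; first exact: lift_vanish sgE hsg fW s0 ff'.
    by rewrite mxE size_divp ?polyXsubC_eq0// size_XsubC subn1; case: size (sf i).
  by apply/matrixP => i j; rewrite ord1 fE f'0 !mxE mul0r.
have [rev0|rev0] := eqVneq (rev_vec d f 0) 0.
  apply: IH dn' => // i; apply/leq_sizeP => j; rewrite leq_eqVlt => /predU1P[<-|dj].
    by have /matrixP /(_ i 0) := rev0; rewrite !mxE horner_rev_poly0.
  by have /leq_sizeP := sf i; apply.
have sg0' z : sg (Some z) != 0 by apply/eqP => e; apply: sg0; exists z.
have := nonvanishing_degree ss sgE hsg sf sg0' rev0.
by move: dn; rewrite mulnS addnC ltn_add2r => /leq_trans h /h; rewrite ltnn.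
Qed.

End Semistability.

(** * Equations of lines in the plane *)

Section PlaneLines.
Variable R : realType.
Local Notation C := (Cx R).
Implicit Types (l : line R) (u v w : 'cV[C]_2).

Definition dot u v : C := u 0 0 * v 0 0 + u 1 0 * v 1 0.

Lemma dotDr u v w : dot u (v + w) = dot u v + dot u w.
Proof. by rewrite /dot !mxE; ring. Qed.

Lemma dotZr u c v : dot u (c *: v) = c * dot u v.
Proof. by rewrite /dot !mxE; ring. Qed.

Lemma dotBr u v w : dot u (v - w) = dot u v - dot u w.
Proof. by rewrite /dot !mxE; ring. Qed.

Lemma dot_sumr (I : Type) (r : seq I) u (F : I -> 'cV[C]_2) :
  dot u (\sum_(i <- r) F i) = \sum_(i <- r) dot u (F i).
Proof.
apply: (big_morph (dot u)) => [v w|]; first exact: dotDr.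
by rewrite -[0](scale0r (0 : 'cV[C]_2)) dotZr mul0r.
Qed.

Definition direction (l : line R) : 'cV[C]_2 := vpick (val l).

Lemma direction_neq0 l : direction l != 0.
Proof. by rewrite vpick0 -dimv_eq0 (eqP (valP l)). Qed.

Lemma line_direction l : val l = <[direction l]>%VS.
Proof.
apply/esym/eqP; rewrite eqEdim dim_vline direction_neq0 (eqP (valP l)) andbT.
by rewrite -memvE memv_pick.
Qed.

Lemma line_inj (l l' : line R) : val l = val l' -> l = l'.
Proof. exact: val_inj. Qed.

Lemma phi_mxE (v : 'cV[C]_2) : phi_mx R *m v = hvec (- v 1 0) (v 0 0).
Proof.
rewrite [LHS]hvec_eta !mxE !big_ord_recl !big_ord0 !mxE /=.
rewrite (_ : lift ord0 ord0 = 1); last exact: val_inj.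
by congr hvec; rewrite ?mul0r ?mul1r ?mulN1r ?addr0 ?add0r.
Qed.

(** For w = (a, b) the vector phi w = (-b, a) is orthogonal to w: phi turns a
    direction of a line into an equation of it.  This is the source of phi in the
    square. *)
Definition normal (l : line R) : 'cV[C]_2 := phi_mx R *m direction l.

Lemma phi_line_normal l : val (phi_line l) = <[normal l]>%VS.
Proof. by rewrite /= line_direction limg_line lfunE. Qed.

Lemma normal_neq0 l : normal l != 0.
Proof.
apply: contra (direction_neq0 l) => /eqP e.
by rewrite -(mulKmx (phi_mx_unit R) (direction l)) -/(normal l) e mulmx0.
Qed.

Lemma mem_lineE l v : (v \in val l) = (dot (normal l) v == 0).
Proof.
set w := direction l.
have -> : dot (normal l) v = w 0 0 * v 1 0 - w 1 0 * v 0 0.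
  by rewrite /normal phi_mxE /dot !mxE /= -/w; ring.
rewrite line_direction -/w; apply/vlineP/eqP => [[k ->]|e].
  by rewrite !mxE; ring.
have w0 : w != 0 := direction_neq0 l.
have [e0|e0] := eqVneq (w 0 0) 0.
  have e1 : w 1 0 != 0.
    apply: contra w0 => /eqP e1; rewrite (hvec_eta w) e0 e1; apply/eqP/matrixP => i j.
    by rewrite !mxE; case: i => [[|[|//]] hi].
  exists (v 1 0 / w 1 0); rewrite [LHS]hvec_eta [RHS]hvec_eta; congr hvec; rewrite mxE.
    rewrite e0 mulr0; move/eqP: e; rewrite e0 mul0r sub0r oppr_eq0 mulf_eq0 (negbTE e1).
    by move/eqP.
  by rewrite divfK.
exists (v 0 0 / w 0 0); rewrite [LHS]hvec_eta [RHS]hvec_eta; congr hvec; rewrite mxE.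
  by rewrite divfK.
apply: (mulfI e0); move/eqP: e; rewrite subr_eq0 => /eqP ->.
by field.
Qed.

End PlaneLines.

(** * Evaluating polynomial vectors against normals of lines *)

Section SliceLinearAlgebra.
Variables (R : realType) (r : nat).
Hypothesis r_gt0 : (0 < r)%N.
Local Notation C := (Cx R).
Variable mu : 'I_(2 * r) -> C.
Implicit Types (U : 'I_(2 * r) -> 'cV[C]_2).

(** The row i is X_i x(mu_i) + Y_i y(mu_i) with (X_i, Y_i) = U i.  By
    [wvec_mx_mul], the matrix maps the coordinates of a polynomial vector f in the
    basis [kbasis] to the numbers U i . f(mu_i). *)
Definition wvec_mx U : 'M[C]_(2 * r) := \matrix_i wvec r (mu i) (U i)^T.

Lemma half_ord (k : 'I_(2 * r)) : (k./2 <= r.-1)%N.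
Proof. by rewrite -ltnS prednK// ltn_half_double -mul2n. Qed.

Lemma wvecE m (u : 'cV[C]_2) k :
  wvec r m u^T 0 k = m ^+ (r.-1 - k./2) * (if odd k then u 1 0 else u 0 0).
Proof.
rewrite !mxE; congr (_ * _); case: (odd k); congr (u _ _); apply: val_inj;
  by rewrite /= inordK.
Qed.

Lemma wvec_xy m X Y :
  wvec r m (hvec X Y)^T = X *: xvec r m + Y *: yvec r m :> 'rV[C]_(2 * r).
Proof.
apply/rowP => k; rewrite [RHS]mxE [in RHS]mxE [X in _ + X]mxE !wvecE !mxE /=.
by case: (odd k); ring.
Qed.

Lemma wvecZ m c (u : 'cV[C]_2) : wvec r m (c *: u)^T = c *: wvec r m u^T.
Proof.
apply/rowP => k; rewrite [RHS]mxE !wvecE !mxE.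
by case: (odd k); ring.
Qed.

Lemma dot_kbasis (u : 'cV[C]_2) z k :
  dot u (eval_vec (kbasis R k) z) = wvec r z u^T 0 k.
Proof.
rewrite wvecE /kbasis /eval_vec map_mxZ /= dotZr /horner_eval hornerXn; congr (_ * _).
by case: (odd k); rewrite /dot !mxE /= /horner_eval ?hornerC ?horner0; ring.
Qed.

Lemma eval_vec_comb (c : 'cV[C]_(2 * r)) z :
  eval_vec (\sum_k (c k 0)%:P *: kbasis R k) z = \sum_k c k 0 *: eval_vec (kbasis R k) z.
Proof.
rewrite /eval_vec raddf_sum; apply: eq_bigr => k _ /=.
by rewrite map_mxZ /= /horner_eval hornerC.
Qed.

Lemma wvec_mx_mul U (c : 'cV[C]_(2 * r)) i : (wvec_mx U *m c) i 0 =
  dot (U i) (eval_vec (\sum_k (c k 0)%:P *: kbasis R k) (mu i)).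
Proof.
rewrite eval_vec_comb dot_sumr mxE; apply: eq_bigr => k _.
by rewrite dotZr dot_kbasis mulrC /wvec_mx mxE.
Qed.

Lemma coef_kbasis (k : 'I_(2 * r)) (b : 'I_2) j :
  (kbasis R k b 0)`_j = ((j == r.-1 - k./2)%N && (b == odd k :> nat))%:R.
Proof.
rewrite /kbasis mxE coefXnM.
have -> : (if odd k then hvec 0 1 else hvec 1 0) b 0 =
    (b == odd k :> nat)%:R%:P :> {poly C}.
  by case: b => [[|[|//]] hb]; case: (odd k); rewrite mxE.
rewrite coefC; case: ltngtP => [lt|gt|->]; rewrite ?subnn//.
by rewrite subn_eq0 leqNgt gt.
Qed.

Lemma size_kbasis (k : 'I_(2 * r)) b : (size (kbasis R k b 0%R) <= r)%N.
Proof.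
apply/leq_sizeP => j rj; rewrite coef_kbasis; case: eqP => // e.
by move: rj; rewrite e leqNgt -[in X in (_ < X)%N](prednK r_gt0) ltnS leq_subr.
Qed.

Lemma kbasis_free (c : 'cV[C]_(2 * r)) :
  \sum_k (c k 0)%:P *: kbasis R k = 0 -> c = 0.
Proof.
move=> e; apply/matrixP => k j; rewrite ord1 [RHS]mxE.
have := congr1 (fun f : 'cV[{poly C}]_2 => (f (inord (odd k)) 0)`_(r.-1 - k./2)) e.
rewrite /= summxE coef_sum mxE coef0 => <-.
rewrite (bigD1 k)//= big1 ?addr0 => [|m mk].
  by rewrite mxE coefCM coef_kbasis eqxx inordK ?eqxx ?mulr1//; case: (odd k).
rewrite mxE coefCM coef_kbasis inordK; last by case: (odd k).
case: andP => [[/eqP e1 /eqP e2]|_]; last by rewrite mulr0.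
case/eqP: mk; apply: val_inj => /=.
rewrite -(odd_double_half m) -(odd_double_half k).
have -> : odd k = odd m by move: e2; case: (odd k); case: (odd m).
by have := half_ord k; have := half_ord m; move: e1; lia.
Qed.

(** An element of the kernel of the matrix is the list of coordinates of a
    polynomial vector of degree < r. *)
Lemma wvec_mx_unit U :
  (forall f : 'cV[{poly C}]_2, (forall i, (size (f i 0%R) <= r)%N) ->
     (forall i, dot (U i) (eval_vec f (mu i)) = 0) -> f = 0) ->
  wvec_mx U \in unitmx.
Proof.
move=> h; rewrite -unitmx_tr -row_free_unit -kermx_eq0.
apply/eqP/row_matrixP => i; rewrite row0; set x := row i _.
have /sub_kermxP xN : (x <= kermx (wvec_mx U)^T)%MS by exact: row_sub.
apply: trmx_inj; rewrite trmx0; apply: kbasis_free.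
apply: h => [b|i0]; last first.
  rewrite -(wvec_mx_mul U) (_ : wvec_mx U *m x^T = 0) ?mxE//.
  by apply: trmx_inj; rewrite trmx_mul trmxK xN trmx0.
apply/leq_sizeP => j rj; rewrite summxE coef_sum big1// => k _.
by rewrite mxE coefCM (leq_sizeP _ _ (size_kbasis k b))// mulr0.
Qed.

(** Let L be a line and u a direction of it.  If U i is proportional to u then the
    row i lies in the space C^r (x) u, of dimension r.  As the rows are independent,
    this happens for at most r indices. *)
Lemma wvec_mx_semistable U (ls : 'I_(2 * r) -> line R) :
  wvec_mx U \in unitmx -> (forall i, val (ls i) = <[U i]>%VS) -> semistable_lines ls.
Proof.
move=> uN lU L; set S := [pred i | _].
suff : (#|S| <= r)%N by rewrite -leq_double -(mul2n r).
pose f (j : 'I_#|S|) : 'I_(2 * r) := enum_val j.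
pose B : 'M[C]_(r, 2 * r) := \matrix_(a, k)
  ((a == (r.-1 - k./2)%N :> nat)%:R * (if odd k then direction L 1 0 else direction L 0 0)).
have sub : (rowsub f (wvec_mx U) <= B)%MS.
  apply/row_subP => j; have : f j \in S by apply: enum_valP.
  rewrite inE => /eqP lL.
  have : U (f j) \in val (ls (f j)) by rewrite lU memv_line.
  rewrite lL line_direction => /vlineP [c Uc].
  apply/submxP; exists (c *: \row_(a < r) (mu (f j)) ^+ a).
  have -> : row j (rowsub f (wvec_mx U)) = wvec r (mu (f j)) (U (f j))^T.
    by apply/rowP => k; rewrite !mxE.
  rewrite Uc wvecZ -scalemxAl; congr (_ *: _); apply/rowP => k; rewrite wvecE mxE.
  have lt : (r.-1 - k./2 < r)%N by rewrite -[X in (_ < X)%N](prednK r_gt0) ltnS leq_subr.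
  rewrite (bigD1 (Ordinal lt))//= big1 ?addr0 => [|a ak].
    by rewrite !mxE /= eqxx mul1r.
  by rewrite !mxE -val_eqE /= in ak *; rewrite (negbTE ak) mul0r mulr0.
have Q : rowsub f 1%:M *m (rowsub f 1%:M)^T = 1%:M :> 'M[C]_(#|S|).
  apply/matrixP => a b; rewrite !mxE (bigD1 (f a))//= big1 ?addr0 => [|k kf].
    by rewrite !mxE eqxx mul1r eq_sym (inj_eq enum_val_inj).
  by rewrite !mxE eq_sym (negbTE kf) mul0r.
rewrite -(mxrank1 C #|S|) -Q; apply: leq_trans (mxrankM_maxl _ _) _.
rewrite -(mxrankMfree _ (_ : row_free (wvec_mx U))) ?row_free_unit// mul_rowsub_mx mul1mx.
exact: leq_trans (mxrankS sub) (rank_leq_row _).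
Qed.

End SliceLinearAlgebra.

(** * Matrices with distinct eigenvalues *)

Section Eigenvectors.
Variables (F : fieldType) (n : nat) (mu : 'I_n -> F).
Hypothesis mu_inj : injective mu.

(** A linear relation between the rows stays one when its coefficients x_i are
    multiplied by mu_i - mu_j.  Doing this for all j <> i leaves only the i-th row. *)
Lemma eigenrows_unit (A N : 'M[F]_n) :
  (forall i, row i N != 0) -> (forall i, row i N *m A = mu i *: row i N) ->
  N \in unitmx.
Proof.
move=> N0 NA; rewrite -row_free_unit -kermx_eq0.
apply/eqP/row_matrixP => a; rewrite row0; set x := row a _.
have xN : x *m N = 0 by apply/sub_kermxP; exact: row_sub.
(* apply A - mu_k to the relation for each k in s *)
have main (s : seq 'I_n) : \sum_i (x 0 i * \prod_(j <- s) (mu i - mu j)) *: row i N = 0.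
  elim: s => [|k s IH].
    transitivity (x *m N); last exact: xN.
    by rewrite mulmx_sum_row; apply: eq_bigr => i _; rewrite big_nil mulr1.
  transitivity ((\sum_i (x 0 i * \prod_(j <- s) (mu i - mu j)) *: row i N) *m (A - (mu k)%:M)).
    rewrite mulmx_suml; apply: eq_bigr => i _.
    rewrite -scalemxAl mulmxBr NA mul_mx_scalar -scalerBl scalerA big_cons.
    by congr (_ *: _); rewrite -mulrA; congr (_ * _); rewrite mulrC.
  by rewrite IH mul0mx.
apply/rowP => i; rewrite [RHS]mxE; apply/eqP.
have := main [seq j <- enum 'I_n | j != i].
rewrite (bigD1 i)//= [X in _ + X]big1 ?addr0 => [|k ki].
  move=> /eqP; rewrite scaler_eq0 (negbTE (N0 i)) orbF mulf_eq0 => /orP[//|].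
  rewrite prodf_seq_eq0 => /hasP[j]; rewrite mem_filter subr_eq0 => /andP[ji _] /=.
  by move=> /eqP/mu_inj ij; rewrite ij eqxx in ji.
rewrite (_ : \prod_(_ <- _) _ = 0) ?mulr0 ?scale0r//; apply/eqP.
rewrite prodf_seq_eq0; apply/hasP; exists k; rewrite ?subrr ?eqxx//.
by rewrite mem_filter ki mem_enum.
Qed.

Lemma eigenrow_unique (A N : 'M[F]_n) (v : 'rV[F]_n) i :
  N \in unitmx -> (forall j, row j N *m A = mu j *: row j N) ->
  v *m A = mu i *: v -> exists c, v = c *: row i N.
Proof.
move=> uN NA vA; pose x := v *m invmx N.
have vE : v = x *m N by rewrite mulmxKV.
exists (x 0 i); rewrite vE.
suff h j : j != i -> x 0 j = 0.
  rewrite mulmx_sum_row (bigD1 i)//= big1 ?addr0// => j /h ->.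
  by rewrite scale0r.
move=> ji.
pose y : 'rV_n := \row_k (x 0 k * (mu k - mu i)).
have yN : y *m N = 0.
  transitivity (v *m A - mu i *: v); last by rewrite vA subrr.
  rewrite [LHS]mulmx_sum_row vE (mulmx_sum_row x N) mulmx_suml scaler_sumr.
  rewrite -sumrB; apply: eq_bigr => k _.
  by rewrite mxE -scalemxAl NA !scalerA -scalerBl; congr (_ *: _); ring.
have : y = 0 by rewrite -(mulmxK uN y) yN mul0mx.
move=> /rowP /(_ j); rewrite !mxE => /eqP; rewrite mulf_eq0 => /orP[/eqP//|].
by rewrite subr_eq0 => /eqP/mu_inj jj; rewrite jj eqxx in ji.
Qed.

Lemma char_poly_eigenrows (A N : 'M[F]_n) :
  N \in unitmx -> (forall j, row j N *m A = mu j *: row j N) ->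
  char_poly A = \prod_i ('X - (mu i)%:P).
Proof.
move=> uN NA.
have /monicP lc := char_poly_monic A.
rewrite (@all_roots_prod_XsubC _ (char_poly A) (codom mu)).
- by rewrite lc scale1r big_map big_enum.
- by rewrite size_char_poly size_codom card_ord.
- apply/allP => _ /codomP [i ->]; rewrite -eigenvalue_root_char; apply/eigenvalueP.
  exists (row i N) => //; apply/eqP => e.
  have : row i (N *m invmx N) = 0 by rewrite row_mul e mul0mx.
  rewrite mulmxV// => /rowP /(_ i); rewrite !mxE eqxx => /eqP.
  by rewrite oner_eq0.
- by rewrite uniq_rootsE map_inj_uniq ?enum_uniq.
Qed.

End Eigenvectors.

(** * Left eigenvectors of matrices in the slice *)

Section SliceEigenvectors.
Variables (R : realType) (r : nat).
Hypothesis r_gt0 : (0 < r)%N.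
Local Notation C := (Cx R).

Lemma lastcol_subproof (b : bool) : ((2 * r.-1) + b < 2 * r)%N.
Proof. by move: r_gt0; case: b; lia. Qed.

Definition lastcol b : 'I_(2 * r) := Ordinal (lastcol_subproof b).

Definition lastvec (v : 'rV[C]_(2 * r)) : 'cV[C]_2 :=
  hvec (v 0 (lastcol false)) (v 0 (lastcol true)).

(** The identity blocks on the superdiagonal give v_k = m v_(k+2) for v A = m v, so
    v is determined by its last two entries. *)
Lemma slice_eigenvector (A : 'M[C]_(2 * r)) m v : seidel_smith_slice A ->
  v *m A = m *: v -> v = wvec r m (lastvec v)^T.
Proof.
move=> sA vA.
have step (k k2 : 'I_(2 * r)) : k.+2 = k2 -> v 0 k = m * v 0 k2.
  move=> kk; have := congr1 (fun w : 'rV_(2 * r) => w 0 k2) vA.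
  rewrite /= [RHS]mxE mxE (bigD1 k)//= big1 ?addr0 => [|l lk].
    by rewrite sA -?kk// eqxx mulr1.
  rewrite sA -?kk// eqSS eqSS (_ : (l == k :> nat) = false) ?mulr0//.
  exact/negbTE.
have main j (k : 'I_(2 * r)) : (r.-1 - k./2)%N = j -> v 0 k = m ^+ j * v 0 (lastcol (odd k)).
  elim: j k => [|j IH] k kj.
    rewrite mul1r; congr (v 0 _); apply: val_inj => /=.
    have := half_ord r_gt0 k; rewrite -[in RHS](odd_double_half k) oddD odd_double.
    have := odd_double_half k; move: kj; case: (odd k) => /=; lia.
  have lt : (k.+2 < 2 * r)%N by have := odd_double_half k; move: kj; case: (odd k) => /=; lia.
  rewrite (step k (Ordinal lt))// (IH (Ordinal lt)) /= ?negbK ?exprS ?mulrA//; lia.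
apply/rowP => k; rewrite wvecE (main _ k erefl); congr (_ * _).
by rewrite !mxE /=; case: (odd k).
Qed.

Lemma lastvec_wvec m (u : 'cV[C]_2) : lastvec (wvec r m u^T) = u.
Proof.
rewrite [RHS]hvec_eta /lastvec !wvecE /= addn0 addn1 /= oddM /= mul2n.
by rewrite doubleK uphalf_double subnn !mul1r.
Qed.

Lemma lastvecZ c (v : 'rV[C]_(2 * r)) : lastvec (c *: v) = c *: lastvec v.
Proof.
apply/matrixP => i j; rewrite !mxE.
by case: i => [[|[|//]] hi] /=.
Qed.

End SliceEigenvectors.

(** * The three maps and the square *)

Lemma Pss_ext (R : realType) n (l l' : Pss R n) :
  (forall i, sval l i = sval l' i) -> l = l'.
Proof. by case: l l' => [l sl] [l' sl'] /= /funext e; apply: eq_exist. Qed.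

Section Square.
Variables (R : realType) (r : nat).
Hypothesis r_gt0 : (0 < r)%N.
Local Notation C := (Cx R).
Variable mu : 'I_(2 * r) -> C.
Hypothesis mu_inj : injective mu.
Local Notation p := (fun i => Some (mu i) : CP1 R).
Local Notation hline := (hline mu_inj).
Implicit Types s : hecke_seq p.

Lemma hs_equiv_refl s : hs_equiv s s.
Proof.
exists (fun _ _ => 1%:M); split=> [//|i|i x]; last by rewrite mul1mx mulmx1.
split=> [a b x ax bx|x]; last exact: unitmx1.
by move=> c d; have := frame_holomorphic ax bx c d; under eq_fun do rewrite -[invmx _]mulmx1.
Qed.

Lemma hs_equiv_hline s s' i : hs_equiv s s' -> val (hline s i) = val (hline s' i).
Proof.
move=> [ph [ph0 iso comm]].
have uph j : ph j (p i) \in unitmx by have [_] := iso j; apply.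
have tot : hs_total s (p i) = hs_total s' (p i) *m ph ord_max (p i).
  rewrite -[hs_total s' _]mul1mx -[X in X *m _ *m _]invmx1 -(ph0 (p i)).
  rewrite /hs_total -(prod_telescope (F := fun j => ph j (p i)))//.
  by apply: eq_bigr => j _; rewrite -mulmxA -comm mulKmx.
apply/vspaceP => v; apply/hlineP/hlineP => -[x ->]; rewrite tot.
  by exists (ph ord_max (p i) *m x); rewrite mulmxA.
by exists (invmx (ph ord_max (p i)) *m x); rewrite -mulmxA mulKVmx.
Qed.

Lemma kamnitzer_rep (h : kamnitzer_space p) : exists2 s0 : hecke_seq p,
  semistable (last_bundle s0) & forall s, sval h s <-> hs_equiv s0 s.
Proof. by case: h => c [s ss /= ->]; exists s. Qed.

(** The lines depend on the equivalence class only.  With U i the equation of the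
    i-th line, a polynomial vector of degree < r in the kernel of the matrix lies in
    the image of the sections of E_n, hence is 0 by [semistable_degree]. *)
Lemma kamnitzer_lines (h : kamnitzer_space p) : exists ls : 'I_(2 * r) -> line R,
  wvec_mx mu (fun i => normal (ls i)) \in unitmx /\
  forall s, sval h s -> forall i, hline s i = ls i.
Proof.
have [s0 ss hs] := kamnitzer_rep h; exists (hline s0); split; last first.
  by move=> s /hs e i; apply: line_inj; apply/esym/hs_equiv_hline.
apply: wvec_mx_unit => // f sf f0.
apply: (semistable_degree (mu_inj := mu_inj) ss _ sf); last by rewrite -addn1 leq_add2l.
by move=> i; rewrite mem_lineE f0.
Qed.

(** The lines spanned by the normals are the images by phi of the lines ls, and
    phi permutes the lines. *)
Lemma normal_line_semistable (ls : 'I_(2 * r) -> line R) :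
  wvec_mx mu (fun i => normal (ls i)) \in unitmx -> semistable_lines ls.
Proof.
move=> uN L.
have := wvec_mx_semistable r_gt0 (ls := fun i => phi_line (ls i)) uN
  (fun i => phi_line_normal (ls i)).
move=> /(_ (phi_line L)); rewrite (@eq_card _ _ [pred i | ls i == L])// => i.
by rewrite !inE (inj_eq (@phi_line_inj R)).
Qed.

Lemma hecke_embedding_exists : exists a : kamnitzer_space p -> Pss R (2 * r),
  is_hecke_embedding a.
Proof.
suff /choice [a ha] : forall h : kamnitzer_space p, exists l : Pss R (2 * r),
    forall s, sval h s -> forall i, val (sval l i) = limg (lin_of_mx (hs_comp s i (p i))).
  by exists a.
move=> h; have [ls [uN hls]] := kamnitzer_lines h.
exists (exist _ ls (normal_line_semistable uN)) => s hs i /=.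
by rewrite -(hls s hs).
Qed.

(** Writing N for the invertible matrix of rows N_i attached to the normals of the
    lines, f is in the image of L_n iff u_i . f(mu_i) = 0 for all i.  So
    f |-> (u_i . f(mu_i))_i identifies L_0 / L_n with C^n, the basis [kbasis] with the
    columns of N, and multiplication by z with diag(mu): the matrix is
    N^-1 diag(mu) N. *)
Lemma kamnitzer_iso_exists : exists K : kamnitzer_space p -> seidel_smith mu,
  is_kamnitzer_iso K.
Proof.
suff /choice [K hK] : forall h : kamnitzer_space p, exists A : seidel_smith mu,
    forall s, sval h s -> is_basis_mod (image_L s) (@kbasis R r) /\
      is_mulz_matrix (image_L s) (@kbasis R r) (sval A).
  by exists K.
move=> h; have [ls [uN hls]] := kamnitzer_lines h.
set U := fun i => normal (ls i) in uN; pose N := wvec_mx mu U.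
pose D := \matrix_i (mu i *: row i N).
have [A NA] : exists A, N *m A = D by exists (invmx N *m D); rewrite mulKVmx.
have colA l : col l (N *m A) = N *m col l A by rewrite colE -mulmxA -colE.
have rNA i : row i N *m A = mu i *: row i N by rewrite -row_mul NA /D rowK.
have charA := char_poly_eigenrows mu_inj uN rNA.
have sA : seidel_smith_slice A.
  move=> k l l2.
  have lt : (l - 2 < 2 * r)%N by apply: leq_ltn_trans (ltn_ord l); rewrite leq_subr.
  have -> : A k l = col l A k 0 by rewrite [RHS]mxE.
  (* z times a basis vector of index l >= 2 is the basis vector of index l - 2 *)
  have -> : col l A = delta_mx (Ordinal lt) 0.
    apply: (can_inj (mulKmx uN)); rewrite -/N -colA NA -colE.
    apply/colP => i; rewrite mxE [LHS]mxE mxE [RHS]mxE /N !rowK.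
    have hl := half_ord r_gt0 l; have lo := odd_double_half l.
    have lo2 := odd_double_half (l - 2).
    have -> : wvec_mx mu U i (Ordinal lt) = wvec r (mu i) (U i)^T 0 (Ordinal lt).
      by rewrite [LHS]mxE.
    rewrite !wvecE mulrA -exprS /= oddB// addbF.
    by congr (_ ^+ _ * _); move: lo2; rewrite oddB// addbF; lia.
  by rewrite mxE eqxx andbT -val_eqE /= -(eqn_add2r 2) subnK// addn2.
exists (exist _ A (conj sA charA)) => s hs /=.
have WE f : image_L s f <-> forall i, dot (U i) (eval_vec f (mu i)) = 0.
  rewrite (image_LE mu_inj); split=> fW i.
    by have := fW i; rewrite (hls s hs) mem_lineE => /eqP.
  by rewrite (hls s hs) mem_lineE fW.
split.
  move=> f; pose b : 'cV[C]_(2 * r) := \col_i dot (U i) (eval_vec f (mu i)).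
  have cE (c : 'cV[C]_(2 * r)) :
      image_L s (f - \sum_k (c k 0)%:P *: kbasis R k) <-> N *m c = b.
    rewrite WE; split=> [e|e i].
      apply/colP => i; rewrite wvec_mx_mul mxE; apply/eqP.
      by rewrite eq_sym -subr_eq0 -dotBr -(e i) /eval_vec map_mxB.
    by rewrite /eval_vec map_mxB dotBr -wvec_mx_mul -/N e mxE subrr.
  exists (invmx N *m b); split; first by apply/cE; rewrite mulKVmx.
  by move=> c /cE <-; rewrite mulKmx.
move=> l; apply/WE => i.
rewrite /eval_vec map_mxB dotBr map_mxZ /= /horner_eval hornerX dotZr dot_kbasis.
have e : \sum_k (A k l)%:P *: kbasis R k = \sum_k ((col l A) k 0)%:P *: kbasis R k.
  by apply: eq_bigr => k _; rewrite mxE.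
by rewrite e -/(eval_vec _ _) -wvec_mx_mul -/N -colA NA !mxE subrr.
Qed.

(** The eigenvectors of A are the rows of a matrix [wvec_mx], which is invertible
    because the eigenvalues are distinct; this also makes each eigenvector unique
    up to a factor. *)
Lemma woodward_embedding_exists : exists w : seidel_smith mu -> Pss R (2 * r),
  is_woodward_embedding w.
Proof.
suff /choice [w hw] : forall A : seidel_smith mu, exists l : Pss R (2 * r),
    forall i (v : 'rV[C]_(2 * r)), v != 0 -> v *m sval A = mu i *: v ->
    exists X Y, v = X *: xvec r (mu i) + Y *: yvec r (mu i) /\
      val (sval l i) = <[hvec X Y]>%VS.
  by exists w.
case=> A [sA cA] /=.
have /choice [v hv] : forall i, exists v : 'rV[C]_(2 * r), v != 0 /\ v *m A = mu i *: v.
  move=> i; have : root (char_poly A) (mu i).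
    by rewrite cA (bigD1 i) //= rootM root_XsubC eqxx.
  by rewrite -eigenvalue_root_char => /eigenvalueP [v vA v0]; exists v.
pose U i := lastvec r_gt0 (v i).
have vE i : v i = wvec r (mu i) (U i)^T.
  by apply: (slice_eigenvector r_gt0 sA); have [] := hv i.
have rowE i : row i (wvec_mx mu U) = v i by rewrite rowK -vE.
have rA i : row i (wvec_mx mu U) *m A = mu i *: row i (wvec_mx mu U).
  by rewrite rowE; have [] := hv i.
have uN : wvec_mx mu U \in unitmx.
  by apply: (eigenrows_unit mu_inj _ rA) => i; rewrite rowE; have [] := hv i.
have U0 i : U i != 0.
  apply/eqP => e; have [+ _] := hv i; rewrite vE e => /eqP; apply.
  by apply/rowP => k; rewrite wvecE !mxE if_same mulr0.
have dimU i : \dim <[U i]>%VS == 1%N by rewrite dim_vline U0.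
pose ls i : line R := exist (fun l : {vspace _} => \dim l == 1%N) _ (dimU i).
exists (exist _ ls (wvec_mx_semistable r_gt0 (ls := ls) uN (fun i => erefl))) => i x x0 xA /=.
have [c xE] := eigenrow_unique mu_inj uN rA xA; rewrite rowE in xE.
have c0 : c != 0 by apply: contra x0 => /eqP c0; rewrite xE c0 scale0r.
exists (lastvec r_gt0 x 0 0), (lastvec r_gt0 x 1 0); split.
  by rewrite -wvec_xy -hvec_eta; apply: slice_eigenvector sA xA.
rewrite -hvec_eta xE lastvecZ -/(U i).
apply/vspaceP => y; apply/vlineP/vlineP => -[k ->].
  by exists (k / c); rewrite scalerA divfK.
by exists (k * c); rewrite scalerA.
Qed.

(** The functional f |-> u_i . f(mu_i), where u_i = phi (direction of l_i), vanishes
    on the image of L_n and takes z f to mu_i times its value at f.  So its matrix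
    X x(mu_i) + Y y(mu_i), with (X, Y) = u_i, is a left eigenvector of K h. *)
Lemma square_commutes (a : kamnitzer_space p -> Pss R (2 * r))
    (K : kamnitzer_space p -> seidel_smith mu) (w : seidel_smith mu -> Pss R (2 * r)) :
  is_hecke_embedding a -> is_kamnitzer_iso K -> is_woodward_embedding w ->
  forall h, phi_star (a h) = w (K h).
Proof.
move=> ha hK hw h.
have [s0 _ hs] := kamnitzer_rep h.
have s0h : sval h s0 by apply/hs; exact: hs_equiv_refl.
apply: Pss_ext => i /=; apply: line_inj.
set l := sval (a h) i.
have lE : l = hline s0 i by apply: line_inj; rewrite /l (ha h s0 s0h).
rewrite phi_line_normal; set u := normal l.
have u0 : u != 0 := normal_neq0 l.
pose v := wvec r (mu i) u^T : 'rV[C]_(2 * r).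
have v0 : v != 0.
  apply: contra u0 => /eqP e; rewrite -(lastvec_wvec r_gt0 (mu i) u) -/v e.
  by apply/eqP/matrixP => a' b'; rewrite !mxE; case: a' => [[|[|//]] ?].
have vA : v *m sval (K h) = mu i *: v.
  apply/rowP => k; have [_ /(_ k) W] := hK h s0 s0h.
  have := image_L_in_lines mu_inj W i; rewrite mem_lineE -lE -/u.
  rewrite /eval_vec map_mxB dotBr map_mxZ /= /horner_eval hornerX dotZr dot_kbasis.
  have e : \sum_j (sval (K h) j k)%:P *: kbasis R j =
      \sum_j ((col k (sval (K h))) j 0)%:P *: kbasis R j.
    by apply: eq_bigr => j _; rewrite mxE.
  rewrite e -/(eval_vec _ _) eval_vec_comb dot_sumr subr_eq0 => /eqP e'.
  rewrite [RHS]mxE e' mxE; apply: eq_bigr => j _.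
  by rewrite dotZr dot_kbasis [RHS]mulrC [col _ _ _ _]mxE.
have [X [Y [vE ->]]] := hw (K h) i v v0 vA.
congr <[_]>%VS; rewrite -wvec_xy in vE.
by rewrite -(lastvec_wvec r_gt0 (mu i) u) -/v vE lastvec_wvec.
Qed.

End Square.

Theorem theorem4p31 (R : realType) (r : nat) (hr : r = 1%N \/ r = 2%N)
    (mu : 'I_(2 * r) -> Cx R) (mu_distinct : injective mu) :
  [/\ exists a : kamnitzer_space (fun i => Some (mu i)) -> Pss R (2 * r),
        is_hecke_embedding a,
      exists K : kamnitzer_space (fun i => Some (mu i)) -> seidel_smith mu,
        is_kamnitzer_iso K,
      exists w : seidel_smith mu -> Pss R (2 * r),
        is_woodward_embedding w &
      forall (a : kamnitzer_space (fun i => Some (mu i)) -> Pss R (2 * r))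
             (K : kamnitzer_space (fun i => Some (mu i)) -> seidel_smith mu)
             (w : seidel_smith mu -> Pss R (2 * r)),
        is_hecke_embedding a -> is_kamnitzer_iso K -> is_woodward_embedding w ->
        forall h, phi_star (a h) = w (K h)].
Proof.
have r_gt0 : (0 < r)%N by case: hr => ->.
split.
- exact: hecke_embedding_exists.
- exact: kamnitzer_iso_exists.
- exact: woodward_embedding_exists.
- exact: square_commutes.
Qed.
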